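(* Let $\gamma$ and $\delta$ be two (complex) algebraic numbers with $\mathrm{Re}(\gamma)>0$ and $\mathrm{Re}(\delta)>0$, which are linearly independent over $\mathbb{Q}$. Let $$T(x)=\#\{(n,m)\in\mathbb{N}^2 : |(e^{\gamma})^n-(e^{\delta})^m|\leq x\}.$$ Then $$T(x)=\frac{(\log x)^2}{\mathrm{Re}(\gamma)\cdot\mathrm{Re}(\delta)}+O(\log x\cdot\log\log x)$$ for $x$ large enough, and the implied constants are effective.
   Context: $\mathbb{N}$ denotes the positive integers. The $O$-constant refers to $x\to\infty$ and may depend on $\gamma,\delta$; ''effective'' means effectively computable. *)

(* Defs.v *)
From HB Require Import structures.
From mathcomp Require Import all_boot all_order all_algebra.
From mathcomp Require Import finmap.
From mathcomp Require Import all_classical all_reals all_analysis.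
From mathcomp Require Export complex.

Set Implicit Arguments.
Unset Strict Implicit.
Unset Printing Implicit Defensive.
Import Order.TTheory GRing.Theory Num.Theory.
Local Open Scope classical_set_scope.
Local Open Scope ring_scope.
Local Open Scope complex_scope.

Definition cexp (R : realType) (z : R[i]) : R[i] :=
  (expR (complex.Re z))%:C * (cos (complex.Im z) +i* sin (complex.Im z)).

Definition lin_indep_rat (R : realType) (g d : R[i]) : Prop :=
  forall a b : rat, ratr a * g + ratr b * d = 0 -> a = 0 /\ b = 0.

Definition Tset (R : realType) (g d : R[i]) (x : R) : set (nat * nat) :=
  [set p | [/\ (0 < p.1)%N, (0 < p.2)%N &
               `|cexp g ^+ p.1 - cexp d ^+ p.2| <= x%:C]].

(* [fset_set] sends infinite sets to the empty one, so a statement about [Tcount]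
   is meaningful only together with [finite_set (Tset g d x)]. *)
Definition Tcount (R : realType) (g d : R[i]) (x : R) : nat :=
  #|` fset_set (Tset g d x)|.

(* Partial recursive functions.  Arguments are untyped lists of naturals; a
   missing argument of [RSucc] or [RProj] is read as 0. *)
Inductive recfun : Type :=
| RZero
| RSucc
| RProj of nat
| RComp of recfun & seq recfun
| RPrec of recfun & recfun
| RMin of recfun.

Inductive computes : recfun -> seq nat -> nat -> Prop :=
| computes_zero s : computes RZero s 0%N
| computes_succ s : computes RSucc s (nth 0%N s 0).+1
| computes_proj i s : computes (RProj i) s (nth 0%N s i)
| computes_comp f gs s t v :
    computes_all gs s t -> computes f t v -> computes (RComp f gs) s v
| computes_prec0 f g s v :
    computes f s v -> computes (RPrec f g) (0%N :: s) v
| computes_precS f g n s u v :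
    computes (RPrec f g) (n :: s) u -> computes g [:: n, u & s] v ->
    computes (RPrec f g) (n.+1 :: s) v
| computes_min f s n (u : nat -> nat) :
    (forall k, (k < n)%N -> computes f (k :: s) (u k).+1) ->
    computes f (n :: s) 0%N -> computes (RMin f) s n
with computes_all : seq recfun -> seq nat -> seq nat -> Prop :=
| computes_nil s : computes_all [::] s [::]
| computes_cons f fs s v vs :
    computes f s v -> computes_all fs s vs ->
    computes_all (f :: fs) s (v :: vs).

Scheme computes_mut_ind := Induction for computes Sort Prop
with computes_all_mut_ind := Induction for computes_all Sort Prop.

Lemma computes_fun f s v w : computes f s v -> computes f s w -> v = w.
Proof.
move=> h; move: w.
apply: (computes_mut_ind
  (P := fun f s v _ => forall w, computes f s w -> v = w)
  (P0 := fun fs s vs _ => forall ws, computes_all fs s ws -> vs = ws))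
  h => {f s v}.
- by move=> s w h; inversion h.
- by move=> s w h; inversion h.
- by move=> i s w h; inversion h.
- move=> f gs s t v _ IHt _ IHv w h; inversion h; subst.
  match goal with H : computes_all gs s _ |- _ => have E := IHt _ H end.
  by apply: IHv; rewrite E.
- by move=> f g s v _ IH w h; inversion h; subst; exact: IH.
- move=> f g n s u v _ IHu _ IHv w h; inversion h; subst.
  match goal with H : computes (RPrec f g) (n :: s) _ |- _ => have E := IHu _ H end.
  by apply: IHv; rewrite E.
- move=> f s n u _ IHu _ IH w h; inversion h; subst.
  case: (ltngtP n w) => // nw.
  + by match goal with H : forall k, is_true (k < w)%N -> _ |- _ =>
      have := IH _ (H _ nw) end.
  + by match goal with H : computes f (w :: s) 0 |- _ =>
      have := IHu _ nw _ H end.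
- by move=> s ws h; inversion h.
- move=> f fs s v vs _ IHv _ IHs ws h; inversion h; subst.
  by congr cons; [exact: IHv | exact: IHs].
Qed.

(* Finite data presenting an algebraic number: a nonzero integer polynomial,
   a centre a + ib and a radius r, with a, b, r rational; the number is the
   only root of the polynomial in the closed disc.  Codes are fed to programs
   through [pickle]. *)
Definition alg_code : Type := ({poly int} * (rat * rat) * rat)%type.

Definition in_disc (R : realType) (c : alg_code) (z : R[i]) : bool :=
  let: (_, (a, b), r) := c in `|z - (ratr a +i* ratr b)| <= (ratr r)%:C.

Definition is_code (R : realType) (c : alg_code) (z : R[i]) : Prop :=
  let p := map_poly intr c.1.1 in
  [/\ c.1.1 != 0, root p z, in_disc c z &
      forall w : R[i], root p w -> in_disc c w -> w = z].

Lemma root_sep (R : realType) (z : R[i]) (s : seq R[i]) :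
  exists2 d : R, 0 < d & forall w, w \in s -> `|w - z| < d%:C -> w = z.
Proof.
elim: s => [|y s [d d0 IH]]; first by exists 1.
have [->|yz] := eqVneq y z.
  by exists d => // w; rewrite inE => /orP[/eqP->//|]; exact: IH.
pose e := complex.Re `|y - z|.
have eE : `|y - z| = e%:C by rewrite /e normc_def.
have e0 : 0 < e by rewrite -ltcR -eE normr_gt0 subr_eq0.
exists (Num.min d e); first by rewrite lt_min d0 e0.
move=> w; rewrite inE => /orP[/eqP->|ws].
  by rewrite eE ltcR lt_min ltxx andbF.
move=> h; apply: IH => //; apply: lt_le_trans h _.
by rewrite lecR ge_min lexx.
Qed.

Lemma rat_near (R : realType) (x e : R) :
  0 < e -> exists q : rat, `|x - ratr q| < e.
Proof.
move=> e0; have [|q] := @rat_in_itvoo R (x - e) (x + e).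
  by rewrite ltrD2l gtrN.
rewrite in_itv /= => /andP[h1 h2]; exists q.
by rewrite distrC ltr_distl h1 h2.
Qed.

Lemma algebraic_has_code (R : realType) (z : R[i]) :
  algebraicOver ratr z <-> exists c, is_code c z.
Proof.
split=> [[p p0 rz]|[c [p0 rz _ _]]]; last first.
  exists (map_poly intr c.1.1); first by rewrite map_poly_eq0_id0 // intr_eq0 lead_coef_eq0.
  rewrite -map_poly_comp (eq_map_poly (g := intr)) // => i /=.
  by rewrite ratr_int.
have [q [a a0 pE]] := rat_poly_scale p.
have q0 : q != 0 by apply: contraNneq p0 => q0; rewrite pE q0 map_poly0 scaler0.
have rq : root (map_poly intr q) z.
  move: rz; rewrite pE map_polyZ rootZ; last by rewrite fmorph_eq0 invr_eq0 intr_eq0.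
  rewrite -map_poly_comp (eq_map_poly (g := intr)) // => i /=.
  by rewrite ratr_int.
have [s sE] := closed_field_poly_normal (map_poly intr q : {poly R[i]}).
have [d d0 dP] := root_sep z s.
have [|r] := @rat_in_itvoo R 0 (d / 2); first by rewrite divr_gt0.
rewrite in_itv /= => /andP[r0 rd].
have r20 : 0 < ratr r / 2 :> R by rewrite divr_gt0.
have [u hu] := rat_near (complex.Re z) r20.
have [v hv] := rat_near (complex.Im z) r20.
have zc : `|z - (ratr u +i* ratr v)| <= (ratr r : R)%:C.
  have -> : z - (ratr u +i* ratr v) =
    (complex.Re z - ratr u)%:C + 'i * (complex.Im z - ratr v)%:C.
    by case: (z) => x y /=; simpc.
  apply: le_trans (ler_normD _ _) _.
  rewrite normrM !normc_def /= !expr0n /= expr1n !addr0 add0r sqrtr1 !sqrtr_sqr.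
  rewrite mul1r -rmorphD lecR /=.
  by rewrite [leRHS](splitr (ratr r : R)) lerD // ltW.
exists (q, (u, v), r); split=> // w rw /= wc; apply: dP.
  move: rw; rewrite sE rootZ ?root_prod_XsubC //.
  by rewrite lead_coef_eq0 map_poly_eq0_id0 // intr_eq0 lead_coef_eq0.
rewrite -(subrKA (ratr u +i* ratr v)).
apply: le_lt_trans (ler_normD _ _) _; rewrite (distrC _ z).
apply: le_lt_trans (lerD wc zc) _.
by rewrite -rmorphD ltcR /= [ltRHS](splitr d) ltrD.
Qed.

(* Main.v *)
Require Import Defs.
From HB Require Import structures.
From mathcomp Require Import all_boot all_order all_algebra.
From mathcomp Require Import all_classical all_reals all_analysis.
From mathcomp Require Import zify ring lra.
From mathcomp Require Import perm mxtens.

Set Implicit Arguments.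
Unset Strict Implicit.
Unset Printing Implicit Defensive.
Import Order.TTheory GRing.Theory Num.Theory.
Local Open Scope classical_set_scope.
Local Open Scope ring_scope.
Local Open Scope complex_scope.

(* A pair (n, m) with n Re(gamma) and m Re(delta) both below log x - 1 is counted
   by T(x).  Conversely, a counted pair has both quantities below log x + 1,
   except when they differ by less than 1; then
   |e^(n gamma) - e^(m delta)| = e^(m Re(delta)) |e^beta - 1| with
   beta = n gamma - m delta, and it suffices to know that
   |e^beta - 1| >= e^(-epsilon (n + m)) for n + m large: such pairs have n = O(log x)
   and boundedly many m for each n.  This even gives the error term O(log x).

   If e^beta is close to 1, then beta is close to some 2 pi i k.  For k = 0 a
   Liouville estimate contradicts linear independence.  For k != 0 the number
   alpha = beta / k is a good approximation of 2 pi i, of bounded degree and of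
   height O(N), N = n + m.  Hermite's type I Pade approximants to
   1, e^z, ..., e^(wz) give integral polynomials T_i, of degree n ~ sqrt(N), that
   are tiny at 2 pi i and not all zero at alpha; a Liouville estimate for
   T_i(alpha) then yields |alpha - 2 pi i| >= N^(-O(sqrt(N))).

   All the constants are explicit functions of a bound K for the degrees and the
   coefficients of integral polynomials vanishing at gamma and delta; such a K is
   read off the codes. *)

(** * Heights: weighted coefficient norms and integer matrices *)

Section WeightedNorm.
Implicit Types (p q : {poly int}) (rho : int).

(** The length of [p(rho X)], hence submultiplicative. A weight above 1 pays in advance for the
    powers of [w!] that later multiply the t-th coefficient. *)
Definition wnorm (rho : int) (p : {poly int}) : int :=
  \sum_(i < size p) `|p`_i| * rho ^+ i.

Lemma wnorm_widen rho p n :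
  (size p <= n)%N -> wnorm rho p = \sum_(i < n) `|p`_i| * rho ^+ i.
Proof.
move=> pn; rewrite /wnorm (big_ord_widen _ (fun i => `|p`_i| * rho ^+ i) pn).
rewrite big_mkcond; apply: eq_bigr => i _; case: ltnP => // ip.
by rewrite nth_default // normr0 mul0r.
Qed.

Lemma wnorm_ge0 rho p : 0 <= rho -> 0 <= wnorm rho p.
Proof. by move=> r0; apply: sumr_ge0 => i _; rewrite mulr_ge0 ?exprn_ge0. Qed.

Lemma wnorm0 rho : wnorm rho 0 = 0.
Proof. by rewrite /wnorm size_poly0 big_ord0. Qed.

Lemma wnormC rho c : wnorm rho c%:P = `|c|.
Proof.
by rewrite (@wnorm_widen _ _ 1) ?size_polyC_leq1 // big_ord1 coefC mulr1.
Qed.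

Lemma wnorm1 rho : wnorm rho 1 = 1. Proof. exact: wnormC. Qed.

Lemma wnormN rho p : wnorm rho (- p) = wnorm rho p.
Proof. by rewrite /wnorm size_polyN; apply: eq_bigr => i _; rewrite coefN normrN. Qed.

Lemma wnormD rho p q : 0 <= rho -> wnorm rho (p + q) <= wnorm rho p + wnorm rho q.
Proof.
move=> r0; pose n := maxn (size p) (size q).
rewrite !(@wnorm_widen _ _ n) ?leq_maxl ?leq_maxr //; last exact: size_polyD.
rewrite -big_split /=; apply: ler_sum => i _; rewrite coefD -mulrDl.
by rewrite ler_wpM2r ?exprn_ge0 ?ler_normD.
Qed.

Lemma wnormZ rho c p : wnorm rho (c *: p) = `|c| * wnorm rho p.
Proof.
rewrite (@wnorm_widen _ _ (size p)) ?size_scale_leq // /wnorm mulr_sumr.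
by apply: eq_bigr => i _; rewrite coefZ normrM mulrA.
Qed.

Lemma wnorm_cons rho p c : wnorm rho (p * 'X + c%:P) = `|c| + rho * wnorm rho p.
Proof.
rewrite (@wnorm_widen _ _ (size p).+1); last first.
  rewrite (leq_trans (size_polyD _ _)) // geq_max (leq_trans (size_polyC_leq1 _)) // andbT.
  by rewrite (leq_trans (size_polyMleq _ _)) // size_polyX addn2.
rewrite big_ord_recl coefD coefMX coefC add0r mulr1; congr (_ + _).
rewrite /wnorm mulr_sumr; apply: eq_bigr => i _.
by rewrite coefD coefMX coefC addr0 exprS mulrCA.
Qed.

Lemma wnormM rho p q : 0 <= rho -> wnorm rho (p * q) <= wnorm rho p * wnorm rho q.
Proof.
move=> r0; elim/poly_ind: p => [|p c IH]; first by rewrite mul0r wnorm0 mul0r.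
rewrite mulrDl mul_polyC -mulrA (mulrC 'X) mulrA.
apply: le_trans (wnormD _ _ r0) _.
rewrite wnorm_cons mulrDl wnormZ addrC lerD2l.
by have := wnorm_cons rho (p * q) 0; rewrite addr0 normr0 add0r => ->; rewrite -mulrA ler_wpM2l.
Qed.

Lemma wnorm_coef p i : `|p`_i| <= wnorm 1 p.
Proof.
have [ip|ip] := ltnP i (size p); last by rewrite nth_default // normr0 wnorm_ge0.
by rewrite /wnorm (bigD1 (Ordinal ip)) //= expr1n mulr1 lerDl sumr_ge0.
Qed.

Lemma wnorm_sum rho (I : Type) (r : seq I) (P : pred I) (f : I -> {poly int}) :
  0 <= rho -> wnorm rho (\sum_(i <- r | P i) f i) <= \sum_(i <- r | P i) wnorm rho (f i).
Proof.
move=> r0; elim/big_rec2: _ => [|i x p _ IH]; first by rewrite wnorm0.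
by apply: le_trans (wnormD _ _ r0) _; rewrite lerD2l.
Qed.

Lemma wnorm_prod rho (I : Type) (r : seq I) (P : pred I) (f : I -> {poly int}) :
  0 <= rho -> wnorm rho (\prod_(i <- r | P i) f i) <= \prod_(i <- r | P i) wnorm rho (f i).
Proof.
move=> r0; elim/big_rec2: _ => [|i x p _ IH]; first by rewrite wnorm1.
by apply: le_trans (wnormM _ _ r0) _; rewrite ler_wpM2l ?wnorm_ge0.
Qed.

Lemma fact_le_expn n : (n`! <= n ^ n)%N.
Proof.
have -> : (n ^ n = \prod_(i < n) n)%N by rewrite prod_nat_const card_ord.
by rewrite fact_prod big_add1 /= big_mkord; apply: leq_prod => i _.
Qed.

(** Leibniz expansion: there are [D! <= D^D] permutations, and every entry of [X - A] has length at
    most [H + 1]. *)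
Lemma wnorm_char_poly D (A : 'M[int]_D) (H : nat) :
  (forall i j, `|A i j| <= H%:Z) -> wnorm 1 (char_poly A) <= ((D * H.+1) ^ D)%:Z.
Proof.
move=> hA; apply: le_trans (wnorm_sum _ _ _ _) _ => //.
have hs (s : {perm 'I_D}) :
    wnorm 1 ((-1) ^+ s * \prod_i char_poly_mx A i (s i)) <= (H.+1 ^ D)%:Z.
  apply: le_trans (wnormM _ _ _) _ => //.
  have -> : wnorm 1 ((-1) ^+ s) = 1.
    by case: (odd_perm s); rewrite ?expr1 ?expr0 ?wnormN wnorm1.
  rewrite mul1r; apply: le_trans (wnorm_prod _ _ _ _) _ => //.
  apply: (@le_trans _ _ (\prod_(i < D) H.+1%:Z)).
    apply: ler_prod => i _; rewrite wnorm_ge0 //= !mxE.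
    apply: le_trans (wnormD _ _ _) _ => //; rewrite wnormN wnormC.
    rewrite -[H.+1]addn1 PoszD addrC lerD //.
    case: eqP => _; rewrite ?mulr1n ?mulr0n ?wnorm0 //.
    by have := wnorm_cons 1 1 0; rewrite mul1r addr0 wnorm1 => ->.
  by rewrite prodr_const card_ord -rmorphXn.
apply: le_trans (ler_sum _ (fun s _ => hs s)) _.
rewrite sumr_const -mulr_natr natz -PoszM lez_nat -cardsE cardsT -mulnC expnMn.
by rewrite leq_mul2r (_ : #|_| = D`!) ?fact_le_expn ?orbT // -[RHS]card_Sn; apply: eq_card => s; rewrite inE.
Qed.

End WeightedNorm.

(** * Algebraic numbers as eigenvalues of integer matrices, and Liouville estimates *)

Section Eigen.
Variable F : numFieldType.
Implicit Types (x v : F).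
Local Notation "A ^F" := (map_mx (intr : int -> F) A) (at level 2).

(* The lowest nonzero coefficient of the characteristic polynomial is a nonzero
   integer. *)
Lemma eigenvalue_lower D (A : 'M[int]_D) (H : nat) x :
  (forall i j, `|A i j| <= H%:Z) -> eigenvalue A^F x -> x != 0 ->
  1 <= `|x| * ((D * H.+1) ^ D)%:R.
Proof.
move=> hA; rewrite eigenvalue_root_char -map_char_poly => rx x0.
have hw := wnorm_char_poly hA.
set q := char_poly A in rx hw; set W := ((D * H.+1) ^ D)%N in hw *.
have q0 : q != 0 by rewrite monic_neq0 ?char_poly_monic.
have W1 : (1 <= W)%N.
  by rewrite -lez_nat (le_trans _ hw) // (le_trans _ (wnorm_coef _ (size q).-1)) //
     -lead_coefE (monicP (char_poly_monic A)).
have [x1|x1] := real_leP (ger0_real ler01) (normr_real x).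
  by rewrite -[leLHS]mulr1 ler_pM // ler1n.
have [m [u u0 qE]] := multiplicity_XsubC q 0.
rewrite q0 /= subr0 in u0 qE.
have ux : root (map_poly (intr : int -> F) u) x.
  move: rx; rewrite qE rmorphM /= rootM => /orP[//|].
  by rewrite rmorphXn /= map_polyX rootE hornerXn expf_eq0 (negPf x0) andbF.
have wu : wnorm 1 u <= W%:Z.
  apply: le_trans hw; rewrite qE; elim: (m) => [|k IH]; first by rewrite mulr1.
  rewrite exprSr mulrA; have := wnorm_cons 1 (u * 'X^k) 0.
  by rewrite addr0 normr0 add0r mul1r => ->.
have {}u0 : u`_0 != 0 by move: u0; rewrite rootE horner_coef0.
move/rootP: ux; rewrite horner_coef size_map_poly_id0; last first.
  by rewrite intr_eq0 lead_coef_eq0; apply: contraNneq u0 => ->; rewrite coef0.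
have su : (0 < size u)%N by rewrite lt0n size_poly_eq0; apply: contraNneq u0 => ->; rewrite coef0.
have E : size u = (size u).-1.+1 by rewrite prednK.
rewrite E big_ord_recl coef_map expr0 mulr1 /= => /eqP; rewrite addr_eq0 => /eqP e.
have h1 : 1 <= `|(u`_0)%:~R : F|.
  by rewrite -intr_norm -[1]/(1%:~R) ler_int -gtz0_ge1 normr_gt0.
apply: (le_trans h1); rewrite e normrN.
apply: (@le_trans _ _ (\sum_(i < (size u).-1) `|x| * (`|u`_(lift ord0 i)|)%:~R)).
  apply: le_trans (ler_norm_sum _ _ _) _; apply: ler_sum => i _.
  rewrite coef_map normrM normrX mulrC lift0 intr_norm ler_wpM2r //.
  by rewrite exprS ler_piMr // exprn_ile1 // ltW.
rewrite -mulr_sumr ler_wpM2l // -rmorph_sum /= -[_%:R]/(W%:Z%:~R) ler_int.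
apply: le_trans wu; rewrite /wnorm E big_ord_recl ler_wpDl ?mulr_ge0 //.
by apply: ler_sum => i _; rewrite expr1n mulr1.
Qed.

(** Summing the moduli of the coordinates of [v A = x v] bounds [|x|] by the largest absolute row
    sum of [A]. *)
Lemma eigenvalue_upper D (A : 'M[int]_D) (H : nat) x :
  (forall i j, `|A i j| <= H%:Z) -> eigenvalue A^F x -> `|x| <= (D * H)%:R.
Proof.
move=> hA /eigenvalueP [v vA v0].
pose S : F := \sum_j `|v 0 j|.
have S0 : 0 < S.
  rewrite lt_def sumr_ge0 // andbT; apply: contraNneq v0 => S0.
  apply/eqP/rowP => j; rewrite mxE; apply/eqP; rewrite -normr_eq0.
  by move/eqP: S0; rewrite psumr_eq0 // => /allP/(_ j); rewrite mem_index_enum => /(_ isT).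
rewrite -(ler_pM2r S0) mulr_sumr.
apply: (@le_trans _ _ (\sum_(j < D) \sum_(i < D) `|v 0 i| * H%:R)).
  apply: ler_sum => j _; rewrite -normrM.
  have -> : x * v 0 j = \sum_i v 0 i * (A i j)%:~R.
    by move/rowP: vA => /(_ j); rewrite !mxE => <-; apply: eq_bigr => i _; rewrite mxE.
  apply: le_trans (ler_norm_sum _ _ _) _; apply: ler_sum => i _.
  by rewrite normrM ler_wpM2l // -intr_norm -[H%:R]/(H%:Z%:~R) ler_int.
under eq_bigr do rewrite -mulr_suml -/S.
rewrite sumr_const card_ord.
by suff -> : (S * H%:R) *+ D = (D * H)%:R * S by []; rewrite natrM -mulr_natl; ring.
Qed.

Lemma expmx_entry_bound D (B : 'M[int]_D) (H t : nat) i j :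
  (forall i j, `|B i j| <= H%:Z) -> `|(B ^+ t) i j| <= ((D * H) ^ t)%:Z.
Proof.
move=> hB; elim: t i j => [|t IH] i j.
  by rewrite expr0 mxE; case: eqP.
rewrite exprSr mxE; apply: le_trans (ler_norm_sum _ _ _) _.
apply: (@le_trans _ _ (\sum_(k < D) ((D * H) ^ t)%:Z * H%:Z)).
  by apply: ler_sum => k _; rewrite normrM ler_pM.
by rewrite sumr_const card_ord -mulr_natr natz -!PoszM lez_nat expnSr -mulnA (mulnC H).
Qed.

(** The same polynomial evaluated at [B] keeps the eigenvector; each further power of [B] costs a
    factor [D b] in the entries. *)
Lemma eigenvalue_poly_int D (B : 'M[int]_D) (b : nat) x (c : nat -> int) n :
  (forall i j, `|B i j| <= b%:Z) -> eigenvalue B^F x ->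
  exists2 A : 'M[int]_D,
    forall i j, `|A i j| <= \sum_(t < n) `|c t| * ((D * b) ^ t)%:Z &
    eigenvalue A^F (\sum_(t < n) (c t)%:~R * x ^+ t).
Proof.
move=> hB /eigenvalueP [v vB v0].
exists (\sum_(t < n) c t *: B ^+ t).
  move=> i j; rewrite summxE; apply: le_trans (ler_norm_sum _ _ _) _.
  by apply: ler_sum => t _; rewrite mxE normrM ler_wpM2l // expmx_entry_bound.
apply/eigenvalueP; exists v => //.
rewrite raddf_sum /= mulmx_sumr scaler_suml; apply: eq_bigr => t _.
rewrite map_mxZ -scalemxAr -scalerA; congr (_ *: _).
elim: (nat_of_ord t) => [|k IH]; first by rewrite !expr0 map_mx1 mulmx1 scale1r.
by rewrite !exprSr map_mxM mulmxA IH -scalemxAl vB scalerA.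
Qed.

(** The companion matrix multiplied by the leading coefficient, so that no division occurs; it acts
    on the row [(1, x, x^2, ...)]. *)
Definition scaled_companion (p : {poly int}) : 'M[int]_((size p).-1) :=
  \matrix_(i, j) if j.+1 == (size p).-1 then - p`_i
                 else if i == j.+1 :> nat then lead_coef p else 0.

Lemma scaled_companionP (p : {poly int}) x :
  root (map_poly intr p) x ->
  (\row_i x ^+ i) *m (scaled_companion p)^F =
  ((lead_coef p)%:~R * x) *: \row_i x ^+ i.
Proof.
move=> rx; apply/rowP => j; rewrite !mxE.
under eq_bigr do rewrite !mxE.
have [jd|jd] := eqVneq j.+1 (size p).-1.
  have sp : size p = (size p).-1.+1.
    by rewrite prednK // -subn_gt0 (leq_trans (_ : (0 < (size p).-1)%N)) ?subn0 ?leq_pred // -jd.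
  move/rootP: rx; rewrite (@horner_coef_wide _ (size p).-1.+1); last by rewrite -sp size_poly.
  rewrite big_ord_recr /= coef_map /= -/(lead_coef p).
  move=> /eqP; rewrite addrC addr_eq0 => /eqP e.
  rewrite -mulrA -exprS jd e -sumrN; apply: eq_bigr => i _.
  by rewrite coef_map /= rmorphN /= mulrN mulrC.
have jd' : (j.+1 < (size p).-1)%N by rewrite ltn_neqAle jd ltn_ord.
rewrite (bigD1 (Ordinal jd')) //= eqxx big1 => [|i ij].
  by rewrite addr0 exprS mulrC mulrA.
by rewrite ifN ?mulr0 //; apply: contraNneq ij => e; apply/eqP/val_inj.
Qed.

Lemma scaled_companion_bound (p : {poly int}) (K : nat) :
  (forall i, `|p`_i| <= K%:Z) -> forall i j, `|scaled_companion p i j| <= K%:Z.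
Proof.
move=> hp i j; rewrite mxE; case: eqP => _; first by rewrite normrN.
by case: eqP => _; rewrite ?normr0 // lead_coefE.
Qed.

Lemma tensmx_bound m n k l (A : 'M[int]_(m, n)) (B : 'M[int]_(k, l)) (a b : int) i j :
  (forall i j, `|A i j| <= a) -> (forall i j, `|B i j| <= b) ->
  `|(A *t B) i j| <= a * b.
Proof. by move=> hA hB; rewrite mxE normrM ler_pM. Qed.

(** With [G] and [E] the scaled companion matrices of [p] and [q], [G *t 1] and [1 *t E] share the
    eigenvector formed by the products [g^i d^j], so integral combinations of the two numbers become
    eigenvalues of a matrix whose entries grow linearly in [N1], [N2]. The integer [a] is the
    product of the leading coefficients. *)
Lemma linear_form_eigenvalue (p q : {poly int}) (K : nat) (g d : F) :
  p != 0 -> q != 0 -> (size p <= K)%N -> (size q <= K)%N ->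
  (forall i, `|p`_i| <= K%:Z) -> (forall i, `|q`_i| <= K%:Z) ->
  root (map_poly intr p) g -> root (map_poly intr q) d ->
  exists (D : nat) (a : int),
    [/\ (D <= K ^ 2)%N, a != 0, `|a| <= (K ^ 2)%:Z &
     forall N1 N2 : int, exists2 B : 'M[int]_D,
       forall i j, `|B i j| <= (`|N1| + `|N2|) * (K ^ 2)%:Z &
       eigenvalue B^F (a%:~R * (N1%:~R * g + N2%:~R * d))].
Proof.
move=> p0 q0 sp sq hp hq rg rd.
have root_size (r : {poly int}) x : r != 0 -> root (map_poly intr r) x -> (0 < (size r).-1)%N.
  move=> r0 rx; rewrite -ltnS prednK ?lt0n ?size_poly_eq0 //.
  apply: (@leq_trans (size (map_poly (intr : int -> F) r))).
    by apply: root_size_gt1 rx; rewrite map_poly_eq0_id0 ?intr_eq0 ?lead_coef_eq0.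
  exact: size_poly.
exists ((size p).-1 * (size q).-1)%N, (lead_coef p * lead_coef q); split.
- by rewrite expnS expn1 leq_mul // (leq_trans (leq_pred _)).
- by rewrite mulf_neq0 ?lead_coef_eq0.
- by rewrite normrM expnS expn1 PoszM ler_pM // lead_coefE.
move=> N1 N2.
set G := scaled_companion p; set E := scaled_companion q.
exists (N1 *: (lead_coef q *: (G *t 1%:M)) + N2 *: (lead_coef p *: (1%:M *t E))).
  have hT1 (i j : 'I_((size p).-1 * (size q).-1)) : `|(G *t 1%:M) i j| <= K%:Z.
    by rewrite -[K%:Z]mulr1 tensmx_bound // => [|k l]; [exact: scaled_companion_bound|rewrite mxE; case: eqP].
  have hT2 (i j : 'I_((size p).-1 * (size q).-1)) : `|(1%:M *t E) i j| <= K%:Z.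
    by rewrite -[K%:Z]mul1r tensmx_bound // => [k l|]; [rewrite mxE; case: eqP|exact: scaled_companion_bound].
  move: (G *t 1%:M) (1%:M *t E) hT1 hT2 => T1 T2 hT1 hT2 i j; rewrite !mxE mulrDl.
  have hl (r : {poly int}) (x : int) : (forall i, `|r`_i| <= K%:Z) -> `|x| <= K%:Z ->
      `|lead_coef r * x| <= (K ^ 2)%:Z.
    by move=> hr hx; rewrite normrM expnS expn1 PoszM ler_pM // lead_coefE.
  by apply: le_trans (ler_normD _ _) _; rewrite !(normrM N1, normrM N2) lerD // ler_wpM2l // hl.
pose u : 'rV[F]_((size p).-1) := \row_i g ^+ i.
pose v : 'rV[F]_((size q).-1) := \row_i d ^+ i.
pose w : 'rV[F]_((size p).-1 * (size q).-1) := u *t v.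
have hG : w *m (G^F *t 1%:M) = ((lead_coef p)%:~R * g) *: w.
  apply: etrans (tensmx_mul u v _ _) _; rewrite mulmx1 scaled_companionP //.
  by apply/matrixP => i j; rewrite !mxE mulrA.
have hE : w *m (1%:M *t E^F) = ((lead_coef q)%:~R * d) *: w.
  apply: etrans (tensmx_mul u v _ _) _; rewrite mulmx1 scaled_companionP //.
  by apply/matrixP => i j; rewrite !mxE mulrCA.
apply/eigenvalueP; exists w.
  rewrite raddfD /= !map_mxZ !map_mxT !map_mx1 mulmxDr -!scalemxAr hG hE.
  by rewrite !scalerA -scalerDl; congr (_ *: _); rewrite rmorphM /=; ring.
(* The coordinate [g^0 d^0 = 1] shows that the common eigenvector is nonzero. *)
apply/eqP => /matrixP/(_ 0 (mxtens_index (Ordinal (root_size _ _ p0 rg), Ordinal (root_size _ _ q0 rd)))).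
by rewrite !mxE mxtens_indexK /= !expr0 mulr1 => /eqP; rewrite oner_eq0.
Qed.

End Eigen.

(** * Pade approximants to exponentials *)

Section Pade.
Variable w : nat.
Implicit Types p q : {poly int}.
Implicit Types (x y : 'I_w.+1 -> {poly int}) (i j l : 'I_w.+1).

(* A family x encodes the exponential polynomial sum_j P_j(z) e^(jz) with
   P_j = sum_t x_jt (w! z)^t / t!.  A step from x to y says that the new form Y
   satisfies Y' - l Y = w! X and Y(0) = 0; the factor w! keeps the coefficients
   integral, as it is divisible by every nonzero j - l. *)
Definition pade_step l x y : Prop :=
  (forall j t, (j%:Z - l%:Z) * (y j)`_t = (w`!)%:Z * ((x j)`_t - (y j)`_t.+1)) /\
  \sum_j (y j)`_0 = 0.

(* The term |q_0| on the left makes the induction close, and later pays for the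
   constant of integration of a step. *)
Lemma poly_recurrence (E e : int) p :
  `|e| <= E -> e != 0 ->
  exists q, [/\ forall t, q`_t = e * (p`_t - q`_t.+1), size q = size p &
    wnorm (2 * E) q + `|q`_0| <= 2 * E * wnorm (2 * E) p].
Proof.
move=> eE e0; have E0 : 0 <= E by apply: le_trans eE.
elim/poly_ind: p => [|p c [q [qt sq nq]]].
  by exists 0; split=> [t||]; rewrite ?wnorm0 ?coef0 ?normr0 ?subr0 ?mulr0 ?addr0.
exists (q * 'X + (e * (c - q`_0))%:P); split.
- by case=> [|t]; rewrite !coefD !coefMX !coefC /= ?addr0 ?add0r.
- rewrite !size_MXaddC sq.
  have -> : (q == 0) = (p == 0) by rewrite -!size_poly_eq0 sq.
  case: (p =P 0) => //= p0; rewrite mulf_eq0 (negPf e0) /=.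
  suff -> : q`_0 = 0 by rewrite subr0.
  by move: sq; rewrite p0 size_poly0 => /eqP; rewrite size_poly_eq0 => /eqP->; rewrite coef0.
- rewrite !wnorm_cons coefD coefMX coefC add0r /=.
  have h : `|e * (c - q`_0)| <= E * (`|c| + `|q`_0|).
    by rewrite normrM ler_pM // ler_normB.
  have h2 : 2 * E * (wnorm (2 * E) q + `|q`_0|) <= 2 * E * (2 * E * wnorm (2 * E) p).
    by rewrite ler_wpM2l ?mulr_ge0.
  lra.
Qed.

(** For [j != l] the recurrence is solved from the top coefficient down, with [e = w!/(j - l)]. For
    [j = l] it is a plain integration: a shift of coefficients and a constant [c], which is fixed by
    requiring the new form to vanish at 0. Only the component at [l] gains a degree. *)
Lemma pade_step_exists l x :
  exists y, [/\ pade_step l x y,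
    forall j, j != l -> size (y j) = size (x j),
    (size (y l) <= (size (x l)).+1)%N,
    x l != 0 -> size (y l) = (size (x l)).+1 &
    \sum_j wnorm (2 * (w`!)%:Z) (y j) <=
      2 * (w`!)%:Z * \sum_j wnorm (2 * (w`!)%:Z) (x j)].
Proof.
set E := (w`!)%:Z.
have E1 : 0 < E by rewrite ltz_nat fact_gt0.
have hz j : exists q, j != l -> [/\ forall t, (j%:Z - l%:Z) * q`_t = E * ((x j)`_t - q`_t.+1),
    size q = size (x j) & wnorm (2 * E) q + `|q`_0| <= 2 * E * wnorm (2 * E) (x j)].
  have [->|jl] := eqVneq j l; first by exists 0.
  have d0 : j%:Z - l%:Z != 0 by rewrite subr_eq0 eqz_nat.
  have [e eE] : exists e, E = e * (j%:Z - l%:Z).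
    apply/dvdzP; rewrite /E dvdzE /= dvdn_fact //.
    by rewrite absz_gt0 d0 /=; have := ltn_ord j; have := ltn_ord l; lia.
  have e0 : e != 0 by apply: contraTneq E1 => e0; rewrite eE e0 mul0r.
  have [|q [qt sq nq]] := @poly_recurrence E e (x j) _ e0.
    rewrite -[X in _ <= X]gtr0_norm // eE normrM ler_peMr //.
    by rewrite -gtz0_ge1 normr_gt0.
  by exists q => _; split=> // t; rewrite {1}qt mulrA (mulrC _ e) -eE.
have [z {}hz] := fin_all_exists hz.
pose c := - \sum_(j | j != l) (z j)`_0.
exists (fun j => if j == l then x l * 'X + c%:P else z j); split.
- split=> [j t|]; last first.
    rewrite (bigD1 l) //= eqxx coefD coefMX coefC /= add0r.
    rewrite [X in _ + X](eq_bigr (fun j => (z j)`_0)) => [|j /negPf-> //].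
    by rewrite /c addNr.
  case: (j =P l) => [->|/eqP jl]; last by have [-> _ _] := hz j jl.
  by rewrite subrr mul0r coefD coefMX coefC /= addr0 subrr mulr0.
- by move=> j jl; rewrite (negPf jl); have [] := hz j jl.
- by rewrite eqxx size_MXaddC; case: ifP.
- by move=> x0; rewrite eqxx size_MXaddC (negPf x0).
- rewrite (bigD1 l) //= [in leRHS](bigD1 l) //= eqxx wnorm_cons mulrDr addrAC addrC lerD2l.
  rewrite mulr_sumr.
  apply: (@le_trans _ _ (\sum_(j | j != l) (wnorm (2 * E) (z j) + `|(z j)`_0|))).
    rewrite big_split /= addrC lerD //; last by rewrite /c normrN ler_norm_sum.
    by rewrite le_eqVlt; apply/orP; left; apply/eqP; apply: eq_bigr => j /negPf->.
  by apply: ler_sum => j jl; have [] := hz j jl.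
Qed.

(** The chain starts from the form [e^(iz)]; the list records the exponents of the steps, the latest
    first. *)
Inductive pade_chain i : seq 'I_w.+1 -> ('I_w.+1 -> {poly int}) -> Prop :=
| pade_chain_nil : pade_chain i [::] (fun j => (j == i)%:R)
| pade_chain_cons l s x y :
    pade_chain i s x -> pade_step l x y -> pade_chain i (l :: s) y.

Section Borel.
Variable F : numFieldType.

Definition borel p : {poly F} :=
  \poly_(t < size p) ((p`_t)%:~R * (w`!)%:R ^+ t / (t`!)%:R).

Lemma coef_borel p t : (borel p)`_t = (p`_t)%:~R * (w`!)%:R ^+ t / (t`!)%:R.
Proof.
rewrite coef_poly; case: ltnP => // pt.
by rewrite nth_default // !mul0r.
Qed.

Lemma size_borel p : size (borel p) = size p.
Proof.
have [->|p0] := eqVneq p 0; first by rewrite /borel size_poly0 poly_def big_ord0 size_poly0.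
apply: size_poly_eq; rewrite !mulf_neq0 ?invr_neq0 ?expf_neq0 ?pnatr_eq0 -?lt0n ?fact_gt0 //.
by rewrite intr_eq0 -lead_coefE lead_coef_eq0.
Qed.

(** This is [Y' - l Y = w! X] read off at each [e^(jz)]: the factors [w!^t / t!] turn the shift of
    coefficients into a derivative. *)
Lemma borel_step l x y : pade_step l x y ->
  (forall j, (borel (y j))^`() + (j%:R - l%:R) *: borel (y j) = (w`!)%:R *: borel (x j)) /\
  \sum_j (borel (y j))`_0 = 0.
Proof.
move=> [h h0]; split=> [j|]; last first.
  under eq_bigr do rewrite coef_borel expr0 mulr1 fact0 divr1.
  by rewrite -rmorph_sum /= h0.
apply/polyP => t; rewrite coefD coef_deriv !coefZ !coef_borel.
have /(congr1 (intr : int -> F)) := h j t.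
rewrite !(rmorphM, rmorphB) /= => {}h.
rewrite -[_ *+ t.+1]mulr_natr exprS factS (natrM _ t.+1).
have t0 : (t`!)%:R != 0 :> F by rewrite pnatr_eq0 -lt0n fact_gt0.
have t1 : t.+1%:R != 0 :> F by rewrite pnatr_eq0.
have -> : (j%:R - l%:R : F) * (((y j)`_t)%:~R * (w`!)%:R ^+ t / (t`!)%:R) =
  ((j%:R - l%:R) * ((y j)`_t)%:~R) * ((w`!)%:R ^+ t / (t`!)%:R) by ring.
by rewrite h; field; rewrite t0 addrC natr1.
Qed.

(* Truncated at order N, the exponentials turn a chain of length s into a family
   of approximations vanishing to order s at the origin. *)
Definition exp_trunc (N : nat) (a : F) : {poly F} := \poly_(k < N) (a ^+ k / (k`!)%:R).

Lemma deriv_exp_trunc N a k : (k.+1 < N)%N ->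
  (exp_trunc N a)^`()`_k = a * (exp_trunc N a)`_k.
Proof.
move=> kN; rewrite coef_deriv !coef_poly kN ltnW //.
rewrite -[_ *+ k.+1]mulr_natr exprS factS (natrM _ k.+1).
have t0 : (k`!)%:R != 0 :> F by rewrite pnatr_eq0 -lt0n fact_gt0.
have t1 : k.+1%:R != 0 :> F by rewrite pnatr_eq0.
by field; rewrite t0 addrC natr1.
Qed.

(** If X vanishes to order [size s] at the origin, then so does [Y' - l Y]; together with [Y(0) = 0]
    this gives Y one more order. Truncation beyond the order in question does not affect the
    coefficients. *)
Lemma pade_chain_order i s x N k : pade_chain i s x -> (size s < N)%N ->
  (k < size s)%N -> (\sum_j borel (x j) * exp_trunc N j%:R)`_k = 0.
Proof.
move=> c; elim: c k => {s x} [//|l s x y _ IH st] k sN.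
have [hd h0] := borel_step st.
elim: k => [_|k IHk ks].
  rewrite coef_sum -[RHS]h0; apply: eq_bigr => j _.
  rewrite coef0M [(exp_trunc _ _)`_0]coef_poly (leq_ltn_trans _ sN) //.
  by rewrite expr0 fact0 divr1 mulr1.
have k1 : k.+1%:R != 0 :> F by rewrite pnatr_eq0.
apply: (mulIf k1); rewrite mul0r mulr_natr -coef_deriv raddf_sum /=.
have kN : (k.+1 < N)%N by apply: leq_trans sN; rewrite ltnS ltnW.
have -> : (\sum_j (borel (y j) * exp_trunc N j%:R)^`())`_k =
   (w`!)%:R * (\sum_j borel (x j) * exp_trunc N j%:R)`_k +
   l%:R * (\sum_j borel (y j) * exp_trunc N j%:R)`_k.
  rewrite !coef_sum !mulr_sumr -big_split /=; apply: eq_bigr => j _.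
  rewrite derivM coefD.
  have -> : (borel (y j) * (exp_trunc N j%:R)^`())`_k = j%:R * (borel (y j) * exp_trunc N j%:R)`_k.
    rewrite !coefM mulr_sumr; apply: eq_bigr => m _.
    have mk : ((k - m).+1 < N)%N by rewrite (leq_ltn_trans _ kN) // ltnS leq_subr.
    rewrite (deriv_exp_trunc _ mk); exact: mulrCA.
  have -> : (borel (y j))^`() = (w`!)%:R *: borel (x j) - (j%:R - l%:R) *: borel (y j).
    by rewrite -hd addrK.
  rewrite mulrBl coefB -!scalerAl !coefZ; ring.
rewrite IH ?IHk ?mulr0 ?addr0 //; exact: ltnW.
Qed.

(** The coefficient at the nominal degree [n] is multiplicative even for factors of smaller degree,
    where it is 0. *)
Lemma coef_prod_top (I : Type) (r : seq I) (f : I -> {poly F}) n :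
  (forall k, (size (f k) <= n.+1)%N) ->
  (size (\prod_(k <- r) f k)%R <= (size r * n).+1)%N /\
  (\prod_(k <- r) f k)`_(size r * n) = \prod_(k <- r) (f k)`_n.
Proof.
move=> hf; elim: r => [|k r [IH1 IH2]]; first by rewrite !big_nil coef1 size_poly1.
rewrite !big_cons /= mulSn; split.
  rewrite (leq_trans (size_polyMleq _ _)) // -subn1 leq_subLR.
  by rewrite (leq_trans (leq_add (hf k) IH1)) // addnS.
rewrite -IH2 coefM (bigD1 (inord n : 'I_(n + size r * n).+1)) //=.
rewrite inordK ?ltnS ?leq_addr // addKn [X in _ + X]big1 ?addr0 // => m.
rewrite -val_eqE /= inordK ?ltnS ?leq_addr // => mn.
have [lt|lt|E] := ltngtP m n; last by rewrite E eqxx in mn.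
  by rewrite [X in _ * X]nth_default ?mulr0 // (leq_trans IH1) //; lia.
by rewrite nth_default ?mul0r // (leq_trans (hf k)).
Qed.

Lemma pade_nonvanishing n s (x : 'I_w.+1 -> 'I_w.+1 -> {poly int}) (a : F) :
  size s = (w.+1 * n)%N ->
  (forall i, pade_chain i s (x i)) ->
  (forall i j, size (x i j) <= n + (i == j))%N ->
  (forall i, size (x i i) = n.+1) -> a != 0 ->
  exists i, (\sum_j borel (x i j)).[a] != 0.
Proof.
move=> ss hc hsz hd a0; apply/existsP; apply: contraT => /existsPn h.
(* M sends the column of truncated exponentials to multiples of X^S, so X^S
   divides det M; its degree is at most S, and its top coefficient is the product
   of those of the diagonal, hence it is a nonzero multiple of X^S. *)
pose M : 'M[{poly F}]_w.+1 := \matrix_(i, j) borel (x i j).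
pose S := (w.+1 * n)%N.
have hM i j : (size (M i j) <= n.+1)%N.
  by rewrite mxE size_borel (leq_trans (hsz i j)) //; case: eqP => _; lia.
have hprod (sg : {perm 'I_w.+1}) :
    (size (\prod_i M i (sg i))%R <= S.+1)%N /\
    (\prod_i M i (sg i))`_S = \prod_i (M i (sg i))`_n.
  have := @coef_prod_top _ (index_enum 'I_w.+1) (fun i => M i (sg i)) n (fun i => hM _ _).
  have -> // : size (index_enum 'I_w.+1) = w.+1.
  by rewrite -sum1_size (eq_bigl (mem 'I_w.+1)) // sum1_card card_ord.
have sdet : (size (\det M) <= S.+1)%N.
  apply: (leq_trans (size_sum _ _ _)); apply/bigmax_leqP => sg _.
  by rewrite -signr_odd; case: odd; rewrite ?expr1 ?expr0 ?mulN1r ?mul1r ?size_polyN (hprod sg).1.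
have tdet : (\det M)`_S != 0.
  have -> : (\det M)`_S = \det (\matrix_(i, j) (M i j)`_n).
    rewrite /determinant coef_sum; apply: eq_bigr => sg _.
    under [in RHS]eq_bigr do rewrite mxE.
    rewrite -(hprod sg).2; case: (odd_perm sg); rewrite ?expr1 ?expr0 ?mul1r //.
    by rewrite !mulN1r coefN.
  have -> : \matrix_(i, j) (M i j)`_n = diag_mx (\row_i (M i i)`_n).
    apply/matrixP => i j; rewrite !mxE; case: eqP => [->|/eqP ij]; first by rewrite mulr1n.
    rewrite mulr0n nth_default // size_borel (leq_trans (hsz i j)) // (negPf ij) addn0.
    exact: leqnn.
  rewrite det_diag; apply/prodf_neq0 => i _; rewrite !mxE.
  have E : n = (size (borel (x i i))).-1 by rewrite size_borel hd.
  rewrite {1}E -lead_coefE lead_coef_eq0 -size_poly_eq0 size_borel hd //.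
have ldet k : (k < S)%N -> (\det M)`_k = 0.
  move=> kS; pose v : 'cV[{poly F}]_w.+1 := \col_j exp_trunc S.+1 j%:R.
  have v0 : v 0 0 = 1.
    apply/polyP => t; rewrite mxE coef_poly coef1; case: t => [|t] /=; first by rewrite expr0 fact0 divr1.
    by rewrite expr0n mul0r if_same.
  (* Cramer's identity [adj M * M = det M], read at index 0, where the truncated exponential is the
     constant 1. *)
  have -> : \det M = ((\det M)%:M *m v) 0 0 by rewrite mul_scalar_mx mxE v0 mulr1.
  rewrite -mul_adj_mx -mulmxA mxE coef_sum big1 // => i _.
  rewrite coefM big1 // => m _.
  suff -> : ((M *m v) i 0)`_(k - m) = 0 by rewrite mulr0.
  rewrite mxE; under eq_bigr do rewrite !mxE.
  by apply: pade_chain_order (hc i) _ _; rewrite ss // (leq_ltn_trans (leq_subr _ _)).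
(* If all the polynomials vanished at [a], the matrix [M] evaluated at [a] would kill the vector of
   ones. *)
have /eqP : (\det M).[a] = 0.
  have hv : map_mx (horner_eval a) M *m (const_mx 1 : 'cV_w.+1) = 0.
    apply/colP => i; rewrite !mxE; have /negPn/eqP := h i.
    rewrite horner_sum => e; rewrite -[RHS]e; apply: eq_bigr => j _.
    by rewrite !mxE mulr1.
  have : (\det (map_mx (horner_eval a) M))%:M *m (const_mx 1 : 'cV[F]_w.+1) = 0.
    by rewrite -mul_adj_mx -mulmxA hv mulmx0.
  by move/colP/(_ 0); rewrite mul_scalar_mx !mxE mulr1 det_map_mx.
rewrite (horner_coef_wide _ sdet) big_ord_recr /= big1 ?add0r => [|k _].
  by rewrite mulf_eq0 (negPf tdet) expf_eq0 (negPf a0) andbF.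
by rewrite ldet ?mul0r.
Qed.
End Borel.

(** Only the steps at [j] lengthen the j-th component, so the degrees are prescribed by the
    multiplicities in [s]; each step costs a factor [2 w!]. *)
Lemma pade_chain_exists i s : exists x,
  [/\ pade_chain i s x,
      forall j, (size (x j) <= count_mem j s + (j == i))%N,
      size (x i) = (count_mem i s).+1 &
      \sum_j wnorm (2 * (w`!)%:Z) (x j) <= (2 * (w`!)%:Z) ^+ size s].
Proof.
elim: s => [|l s [x [c h1 h2 h3]]].
  exists (fun j => (j == i)%:R); split=> //.
  - exact: pade_chain_nil.
  - by move=> j; case: eqP; rewrite ?size_poly1 ?size_poly0.
  - by rewrite eqxx size_poly1.
  - rewrite expr0 (bigD1 i) //= eqxx wnorm1 big1 ?addr0 // => j /negPf->.
    by rewrite wnorm0.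
have [y [st g1 g2 g3 g4]] := pade_step_exists l x.
exists y; split.
- exact: pade_chain_cons c st.
- move=> j /=; have [lj|jl] := eqVneq l j.
    by subst j; rewrite (leq_trans g2) // add1n addSn ltnS.
  by rewrite add0n g1 // eq_sym.
- have [E|jl] := eqVneq i l.
    by subst l; rewrite /= eqxx g3 ?h2 // -size_poly_eq0 h2.
  by rewrite /= eq_sym (negPf jl) add0n g1.
- apply: (le_trans g4); rewrite /= exprS ler_wpM2l //.
Qed.

End Pade.

(** * Size of the approximants on the imaginary axis *)

Section Smallness.
Variable R : realType.
Local Notation C := R[i].

Definition cis (y : R) : C := cos y +i* sin y.

Lemma cisD x y : cis (x + y) = cis x * cis y.
Proof. by rewrite /cis cosD sinD; simpc; rewrite [sin x * _ + _]addrC. Qed.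

Lemma cis0 : cis 0 = 1. Proof. by rewrite /cis cos0 sin0. Qed.

Lemma normr_cis y : `|cis y| = 1.
Proof. by rewrite normc_def /= cos2Dsin2 sqrtr1. Qed.

Lemma cis_2pi n : cis (n%:R * (pi *+ 2)) = 1.
Proof.
elim: n => [|n IH]; first by rewrite mul0r cis0.
by rewrite -natr1 mulrDl mul1r cisD IH mul1r /cis cos2pi sin2pi.
Qed.

Lemma Re_real_mul (y : R) (z : C) : complex.Re (y%:C * z) = y * complex.Re z.
Proof. by case: z => a b /=; rewrite mul0r subr0. Qed.

Lemma natrC n : (n%:R : R)%:C = n%:R.
Proof. exact: (rmorph_nat (real_complex R)). Qed.

Lemma ReD (z z' : C) : complex.Re (z + z') = complex.Re z + complex.Re z'.
Proof. by case: z z' => ? ? []. Qed.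

Lemma is_derive_Re_cis (w : C) (l y : R) :
  is_derive y 1 (fun y : R => complex.Re (w * cis (l * y)))
    (complex.Re (w * ('i * l%:C) * cis (l * y))).
Proof.
have -> : (fun y : R => complex.Re (w * cis (l * y))) =
   (complex.Re w *: (cos \o ( *%R l)) - complex.Im w *: (sin \o ( *%R l))).
  by apply/funext => t; case: (w) => a b /=.
have hl : is_derive y 1 ( *%R l) l.
  by have := is_deriveZ l (is_derive_id y 1); rewrite /GRing.scale /= mulr1.
have hc := is_derive1_comp (is_derive_cos (l * y)) hl.
have hs := is_derive1_comp (is_derive_sin (l * y)) hl.
apply: is_derive_eq.
by case: (w) => a b /=; rewrite /GRing.scale /=; ring.
Qed.

(** Taking real parts makes real calculus available. The free factor [u] carries the induction on
    [P], where it absorbs ['i], and serves later as a rotation. *)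
Lemma is_derive_Re_poly_cis (P : {poly C}) (u : C) (l y : R) :
  is_derive y 1 (fun y : R => complex.Re (u * P.['i * y%:C] * cis (l * y)))
    (complex.Re (u * 'i * (P^`() + l%:C *: P).['i * y%:C] * cis (l * y))).
Proof.
elim/poly_ind: P u => [|P c IH] u.
  rewrite deriv0 scaler0 addr0 horner0 mulr0 mul0r.
  have -> : (fun y : R => complex.Re (u * (0 : {poly C}).['i * y%:C] * cis (l * y))) = cst 0.
    by apply/funext => t; rewrite horner0 mulr0 mul0r.
  exact: is_derive_cst.
pose f t := complex.Re (u * 'i * P.['i * t%:C] * cis (l * t)).
pose g t := complex.Re (u * c * cis (l * t)).
have -> : (fun y : R => complex.Re (u * (P * 'X + c%:P).['i * y%:C] * cis (l * y))) = id * f + g.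
  apply/funext => t; rewrite -[RHS]/(t * f t + g t) -Re_real_mul -ReD; congr complex.Re.
  by rewrite hornerMXaddC; ring.
have h1 : is_derive y 1 f _ := IH (u * 'i); have h2 : is_derive y 1 g _ := is_derive_Re_cis (u * c) l y.
apply: is_derive_eq.
rewrite -[X in X + _]/(y * _ + f y * 1) mulr1 -Re_real_mul -!ReD; congr complex.Re.
by rewrite !(derivD, derivM, derivX, derivC, hornerD, hornerZ, hornerM, hornerX, hornerC); ring.
Qed.

Lemma is_derive_divided_power (E : R) n (t : R) :
  is_derive t (1 : R) (fun t => (E * t) ^+ n.+1 / (n.+1)`!%:R) (E * ((E * t) ^+ n / n`!%:R)).
Proof.
pose g : R -> R := *%R E.
have hg : is_derive t (1 : R) g E.
  by have := is_deriveZ E (is_derive_id t (1 : R)); rewrite /GRing.scale /= mulr1.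
have -> : (fun t => (E * t) ^+ n.+1 / (n.+1)`!%:R) = ((n.+1)`!%:R^-1 : R) \*: (g ^+ n.+1).
  by apply/funext => v; rewrite exprfctE mulrC.
apply: is_derive_eq.
rewrite /GRing.scale /= /g factS (natrM _ n.+1).
have f0 : (n`!)%:R != 0 :> R by rewrite pnatr_eq0 -lt0n fact_gt0.
have s0 : n.+1%:R != 0 :> R by rewrite pnatr_eq0.
by field; rewrite f0 addrC natr1.
Qed.

(* On the imaginary axis |e^(lz)| = 1, so e^(-lz) times the form obtained by a step
   at l has a derivative of the same modulus as w! times the previous form. *)
Lemma pade_chain_small (w : nat) (i : 'I_w.+1) s x (y : R) :
  pade_chain i s x -> 0 <= y ->
  `|\sum_j (borel w C (x j)).['i * y%:C] * cis (j%:R * y)| <=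
    (((w`!)%:R * y) ^+ size s / (size s)`!%:R)%:C.
Proof.
move=> c; elim: c y => {s x} [|l s x z _ IH st] y y0.
  rewrite (bigD1 i) //= eqxx big1 ?addr0 => [|j /negPf->]; last first.
    by rewrite /borel size_poly0 poly_def big_ord0 horner0 mul0r.
  rewrite /borel size_poly1 poly_def big_ord1 coef1 expr0 fact0 !mulr1 divr1 scale1r expr0 hornerC mul1r.
  by rewrite mul1r normr_cis invr1.
have [hd h0] := borel_step C st.
pose E : R := (w`!)%:R; pose S := size s.
pose G (t : R) := \sum_j (borel w C (z j)).['i * t%:C] * cis ((j%:R - l%:R) * t).
have GE (t : R) : \sum_j (borel w C (z j)).['i * t%:C] * cis (j%:R * t) = cis (l%:R * t) * G t.
  rewrite /G mulr_sumr; apply: eq_bigr => j _.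
  by rewrite mulrCA -cisD; congr (_ * cis _); ring.
rewrite GE normrM normr_cis mul1r.
have [->|G0] := eqVneq (G y) 0.
  by rewrite normr0 lecR divr_ge0 ?exprn_ge0 ?mulr_ge0.
(* The rotation that brings [G y] onto the positive real axis, so that its modulus is the real part
   [h y]. *)
pose u := (G y)^* / `|G y|.
have hu : u * G y = `|G y|.
  by rewrite /u mulrAC mulrC -[X in _ * X]mulrC -sqr_normc mulrC expr2 mulfK ?normr_eq0.
have nu : `|u| = 1.
  by rewrite /u normrM normrV ?unitfE ?normr_eq0 // normr_id normcJ divff ?normr_eq0.
clearbody u.
pose h (t : R) := complex.Re (u * G t).
pose dG (t : R) := u * 'i * (E%:C * \sum_j (borel w C (x j)).['i * t%:C] * cis ((j%:R - l%:R) * t)).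
have hder (t : R) : is_derive t (1 : R) h (complex.Re (dG t)).
  have -> : h = \sum_(j < w.+1) (fun t : R => complex.Re (u * (borel w C (z j)).['i * t%:C] * cis ((j%:R - l%:R) * t))).
    apply/funext => v; rewrite /h /G mulr_sumr fct_sumE.
    by rewrite (big_morph _ ReD (erefl : complex.Re 0 = 0)); apply: eq_bigr => j _; rewrite mulrA.
  have hj (j : 'I_w.+1) := is_derive_Re_poly_cis (borel w C (z j)) u (j%:R - l%:R) t.
  apply: is_derive_eq.
  rewrite -(big_morph _ ReD (erefl : complex.Re 0 = 0)); congr complex.Re.
  rewrite /dG mulrA mulr_sumr; apply: eq_bigr => j _.
  by rewrite rmorphB /= /E !natrC hd hornerZ; ring.
(* The difference between [h] and the claimed bound: it is 0 at the origin, because the form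
   vanishes there, and it decreases by the induction hypothesis. *)
pose k (t : R) := h t - (E * t) ^+ S.+1 / (S.+1)`!%:R.
pose dk (t : R) := complex.Re (dG t) - E * ((E * t) ^+ S / S`!%:R).
have kder (t : R) : is_derive t (1 : R) k (dk t).
  exact: is_deriveB (hder t) (is_derive_divided_power E S t).
have dk0 (t : R) : 0 <= t -> dk t <= 0.
  move=> t0; rewrite subr_le0.
  have : (complex.Re (dG t))%:C <= `|dG t|.
    by apply: le_trans (normc_ge_Re _); rewrite lecR ler_norm.
  rewrite -lecR => h1; apply: le_trans h1 _.
  have := IH t t0.
  have -> : \sum_j (borel w C (x j)).['i * t%:C] * cis (j%:R * t) =
      cis (l%:R * t) * \sum_j (borel w C (x j)).['i * t%:C] * cis ((j%:R - l%:R) * t).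
    rewrite mulr_sumr; apply: eq_bigr => j _.
    by rewrite mulrCA -cisD; congr (_ * cis _); ring.
  rewrite normrM normr_cis mul1r => h2.
  rewrite /dG !normrM nu mul1r rmorphM /=.
  have -> : `|'i : C| = 1 by rewrite normc_def /= expr0n expr1n add0r sqrtr1.
  rewrite mul1r ler_pM // ger0_norm // ler0c; exact: ler0n.
have : k y <= k 0.
  have cont : {within `[0, y], continuous k}.
    by apply: derivable_within_continuous => t _; case: (kder t).
  apply: (ler0_derive1_le_cc _ _ cont); rewrite ?in_itv /= ?lexx ?y0 //.
  move=> t; rewrite in_itv /= => /andP[/ltW t0 _].
  by rewrite derive1E; case: (kder t) => _ ->; exact: dk0.
rewrite /k mulr0 expr0n /= mul0r subr0.
have -> : h 0 = 0.
  rewrite /h /G; under eq_bigr do rewrite !mulr0 cis0 mulr1 horner_coef0.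
  by rewrite h0 mulr0.
rewrite subr_le0 /h hu -lecR RRe_real ?normr_real //.
Qed.

(** At [2 pi i] all the exponentials [e^(jz)] equal 1, so the form collapses to a polynomial
    value. *)
Lemma pade_chain_2pi (w : nat) (i : 'I_w.+1) s x :
  pade_chain i s x ->
  `|\sum_j (borel w C (x j)).['i * (pi *+ 2)%:C]| <=
    (((w`!)%:R * (pi *+ 2)) ^+ size s / (size s)`!%:R)%:C.
Proof.
move=> c; have := pade_chain_small c (mulrn_wge0 2 (pi_ge0 R)).
by under eq_bigr do rewrite cis_2pi mulr1.
Qed.

End Smallness.

(** * Approximation of 2 pi i by algebraic numbers *)

Section Transcendence.
Variable R : realType.
Local Notation C := R[i].

Lemma subrX_bound (F : numFieldType) (a z : F) (r : F) n t :
  1 <= r -> `|a| <= r -> `|z| <= r -> (t <= n)%N ->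
  `|a ^+ t - z ^+ t| <= `|a - z| * (n%:R * r ^+ n).
Proof.
move=> r1 ar zr tn; have r0 : 0 <= r by apply: le_trans ar.
rewrite subrXX normrM ler_wpM2l //.
apply: le_trans (ler_norm_sum _ _ _) _.
apply: (@le_trans _ _ (\sum_(i < t) r ^+ n)).
  apply: ler_sum => i _; rewrite normrM !normrX.
  apply: (@le_trans _ _ (r ^+ (t.-1 - i) * r ^+ i)).
    by rewrite ler_pM ?exprn_ge0 // lerXn2r ?nnegrE.
  by rewrite -exprD ler_weXn2l //; have := ltn_ord i; lia.
by rewrite sumr_const card_ord -[_ *+ t]mulr_natl ler_wpM2r ?exprn_ge0 // ler_nat.
Qed.

(** Multiplying the Borel transform by [n!] makes its coefficients integral; the falling factorial
    is [n!/t!] for [t <= n]. *)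
Definition scaled_coef (w n : nat) (X : {poly int}) (t : nat) : int :=
  X`_t * (w`!)%:Z ^+ t * (n ^_ (n - t))%:Z.

Lemma borel_sum_horner (F : numFieldType) w n (x : 'I_w.+1 -> {poly int}) (z : F) :
  (forall j, size (x j) <= n.+1)%N ->
  (n`!)%:R * (\sum_j borel w F (x j)).[z] =
  \sum_(t < n.+1) (scaled_coef w n (\sum_j x j) t)%:~R * z ^+ t.
Proof.
move=> hx; rewrite (@horner_coef_wide _ n.+1); last first.
  apply: leq_trans (size_sum _ _ _) _; apply/bigmax_leqP => j _.
  by rewrite size_borel.
rewrite mulr_sumr; apply: eq_bigr => t _; rewrite mulrA; congr (_ * _).
rewrite /scaled_coef coef_sum mulr_sumr.
have tn : (n - t <= n)%N by exact: leq_subr.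
have fE : (n`!)%:R = (n ^_ (n - t))%:R * (t`!)%:R :> F.
  have tt : (n - (n - t) = t)%N by rewrite subKn // -ltnS.
  by rewrite -natrM -{2}tt ffact_fact.
rewrite coef_sum !rmorphM /= rmorph_sum /= !mulr_suml; apply: eq_bigr => j _.
rewrite coef_borel fE rmorphXn /=.
have t0 : (t`!)%:R != 0 :> F by rewrite pnatr_eq0 -lt0n fact_gt0.
by rewrite -!pmulrn; field.
Qed.

(** The weight [2 w!] of the norm dominates the factor [w!^t], and [n!/t! <= n!]. *)
Lemma scaled_coef_bound w n x (c : nat) :
  (\sum_(j < w.+1) wnorm (2 * (w`!)%:Z) (x j) <= c%:Z) ->
  (forall j, size (x j) <= n.+1)%N ->
  \sum_(t < n.+1) `|scaled_coef w n (\sum_j x j) t| <= (n`! * c)%N%:Z.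
Proof.
move=> hx hs; rewrite PoszM; apply: le_trans (ler_wpM2l _ hx) => //.
apply: (@le_trans _ _ ((n`!)%:Z * wnorm (w`!)%:Z (\sum_j x j))).
  rewrite (@wnorm_widen _ _ n.+1); last first.
    apply: leq_trans (size_sum _ _ _) _; apply/bigmax_leqP => j _; exact: hs.
  rewrite mulr_sumr; apply: ler_sum => t _.
  rewrite /scaled_coef normrM [leRHS]mulrC ler_pM //; first by rewrite normrM normrX.
  by rewrite lez_nat -(ffact_fact (leq_subr t n)) leq_pmulr ?fact_gt0.
rewrite ler_wpM2l //; apply: le_trans (wnorm_sum _ _ _ _) _ => //.
apply: ler_sum => j _; apply: ler_sum => t _.
by rewrite ler_wpM2l // lerXn2r ?nnegrE // ler_peMl.
Qed.

Lemma count_nseq_ord w n (l : 'I_w.+1) :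
  count_mem l (flatten (nseq n (enum 'I_w.+1))) = n.
Proof.
elim: n => //= n IH; rewrite count_cat IH count_uniq_mem ?enum_uniq //.
by rewrite mem_enum.
Qed.

Lemma size_nseq_ord w n : size (flatten (nseq n (enum 'I_w.+1))) = (w.+1 * n)%N.
Proof. by elim: n => [|n IH] /=; rewrite ?muln0 // size_cat IH size_enum_ord mulnS. Qed.

Lemma double_pi_le8 : pi *+ 2 <= 8 :> R.
Proof.
have := pihalf_lt2 R; rewrite ltr_pdivrMr // => /ltW h.
apply: le_trans (ler_wMn2r 2 h) _.
by rewrite -natrM -mulrnA.
Qed.

Lemma double_pi_ge0 : 0 <= pi *+ 2 :> R.
Proof. exact: mulrn_wge0 (pi_ge0 R).
Qed.

(** Some approximant T is nonzero at [th / m], and [m^n T(th / m)] is an eigenvalue of an integer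
    matrix, so it is not too small. From above, T is tiny at [2 pi i] and moves by at most [eta]
    times a Lipschitz constant between the two points. *)
Lemma pi_transcendence_inequality (w n s c D b H0 : nat) (B : 'M[int]_D) (th : C) (m : int) (eta : R) :
  s = (w.+1 * n)%N -> c = ((2 * w`!) ^ s)%N ->
  (forall i j, `|B i j| <= H0%:Z) -> (D * H0 <= b)%N ->
  eigenvalue (map_mx intr B) th -> th != 0 ->
  m != 0 -> `|m| <= b%:Z ->
  `|th / m%:~R| <= 16 -> `|th / m%:~R - 'i * (pi *+ 2)%:C| <= eta%:C ->
  1 <= (b ^ n)%:R * (n`!%:R * ((8 * w`!) ^ s)%:R / (s`!)%:R + eta * (n`! * c * (n * 16 ^ n))%:R)
       * ((D * (n`! * c * b ^ n).+1) ^ D)%:R.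
Proof.
move=> sE cE hB hb eB th0 m0 mb al16 aleta.
have mF : m%:~R != 0 :> C by rewrite intr_eq0.
set al := th / m%:~R in al16 aleta.
(* [n] full rounds through the exponents [0, ..., w] give all components about the same size. *)
pose sq := flatten (nseq n (enum 'I_w.+1)).
have [x hx] := fin_all_exists (fun i => @pade_chain_exists w i sq).
have sN i j : (size (x i j) <= n + (j == i))%N by have [_ /(_ j)] := hx i; rewrite count_nseq_ord.
have [|||||i nz] := @pade_nonvanishing w C n sq x al.
- exact: size_nseq_ord.
- by move=> i; have [] := hx i.
- by move=> i j; rewrite eq_sym.
- by move=> i; have [_ _ -> _] := hx i; rewrite count_nseq_ord.
- by rewrite mulf_neq0 ?invr_neq0.
have [hc _ _ hw] := hx i.
have sx j : (size (x i j) <= n.+1)%N by apply: leq_trans (sN i j) _; case: eqP; lia.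
have hw' : \sum_j wnorm (2 * (w`!)%:Z) (x i j) <= c%:Z.
  by apply: le_trans hw _; rewrite size_nseq_ord -sE cE -PoszM -rmorphXn.
have hsc := scaled_coef_bound hw' sx.
set X := \sum_j x i j in hsc.
pose T (z : C) := \sum_(t < n.+1) (scaled_coef w n X t)%:~R * z ^+ t.
have TE z : (n`!)%:R * (\sum_j borel w C (x i j)).[z] = T z by exact: borel_sum_horner.
have T0 : T al != 0.
  by rewrite -TE mulf_neq0 // pnatr_eq0 -lt0n fact_gt0.
(* The factors [m^(n - t)] homogenize T and so clear the denominator of [th / m]. *)
have [A hA eA] := eigenvalue_poly_int (fun t => scaled_coef w n X t * m ^+ (n - t)) n.+1 hB eB.
have thE : \sum_(t < n.+1) (scaled_coef w n X t * m ^+ (n - t))%:~R * th ^+ t = m%:~R ^+ n * T al.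
  rewrite mulr_sumr; apply: eq_bigr => t _; rewrite rmorphM rmorphXn /= expr_div_n.
  have nE : (n = (n - t) + t)%N by rewrite subnK // -ltnS.
  have -> : m%:~R ^+ n = m%:~R ^+ (n - t) * m%:~R ^+ t :> C by rewrite -exprD -nE.
  by field; rewrite expf_neq0.
rewrite thE in eA.
have hA' i' j' : `|A i' j'| <= (n`! * c * b ^ n)%N%:Z.
  apply: le_trans (hA i' j') _; rewrite PoszM.
  apply: le_trans (ler_wpM2r _ hsc) => //; rewrite mulr_suml; apply: ler_sum => t _.
  rewrite normrM -mulrA ler_wpM2l // normrX.
  have -> : (b ^ n = b ^ (n - t) * b ^ t)%N by rewrite -expnD subnK // -ltnS.
  rewrite PoszM.
  have hbt : ((D * H0) ^ t <= b ^ t)%N by case: (nat_of_ord t) => // t'; rewrite leq_exp2r.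
  rewrite ler_pM ?exprn_ge0 //.
  have -> : (b ^ (n - t))%N%:Z = b%:Z ^+ (n - t) by rewrite -[b%:Z]natz -natrX natz.
  by rewrite lerXn2r ?nnegrE.
have /(eigenvalue_lower hA' eA) h1 : m%:~R ^+ n * T al != 0 by rewrite mulf_neq0 ?expf_neq0.
have eta0 : 0 <= eta by rewrite -ler0c; apply: le_trans aleta.
rewrite -lecR; apply: le_trans h1 _.
rewrite !rmorphM rmorphD /= !natrC ler_wpM2r ?ler0n // normrM normrX.
have hm : `|m%:~R : C| <= b%:R by rewrite -intr_norm -[b%:R]/(b%:Z%:~R) ler_int.
rewrite ler_pM ?exprn_ge0 //; first by rewrite natrX lerXn2r ?nnegrE.
pose z : C := 'i * (pi *+ 2)%:C.
have nz8 : `|z| <= 8.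
  rewrite /z normrM.
  have -> : `|'i : C| = 1 by rewrite normc_def /= expr0n expr1n add0r sqrtr1.
  rewrite mul1r ger0_norm ?ler0c ?double_pi_ge0 //.
  by rewrite -[8]/(8%:R) -natrC lecR double_pi_le8.
rewrite -(subrK (T z) (T al)) addrC; apply: le_trans (ler_normD _ _) _.
apply: lerD.
  rewrite -TE normrM ger0_norm ?ler0n // -mulrA rmorphM /= natrC ler_wpM2l ?ler0n //.
  have h2pi := pade_chain_2pi R hc; rewrite size_nseq_ord -sE in h2pi.
  rewrite horner_sum; apply: (le_trans h2pi); rewrite lecR ler_wpM2r ?invr_ge0 ?ler0n //.
  rewrite natrX lerXn2r ?nnegrE ?mulr_ge0 ?double_pi_ge0 ?ler0n //.
  by rewrite natrM mulrC ler_wpM2r ?ler0n ?double_pi_le8.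
rewrite /T -sumrB; apply: le_trans (ler_norm_sum _ _ _) _.
apply: (@le_trans _ _ (\sum_(t < n.+1) (`|scaled_coef w n X t|)%:~R * (`|al - z| * (n%:R * 16 ^+ n)))).
  apply: ler_sum => t _; rewrite -mulrBr normrM intr_norm ler_wpM2l //.
  apply: subrX_bound; [by rewrite ler1n | exact: al16 | | by rewrite -ltnS].
  by apply: (le_trans nz8); rewrite ler_nat.
rewrite -mulr_suml -rmorph_sum /= mulrCA.
have -> : (eta * (n`!%:R * c%:R * (n%:R * (16 ^ n)%:R)))%:C =
    eta%:C * ((n`! * c)%N%:Z%:~R * (n%:R * 16 ^+ n)) :> C.
  rewrite !(rmorphM (real_complex R)) /= !natrC -[(n`! * c)%N%:Z%:~R]/((n`! * c)%:R).
  by rewrite natrM natrX.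
apply: ler_pM => //.
  by rewrite mulr_ge0 ?mulr_ge0 ?exprn_ge0 ?ler0n // ler0z sumr_ge0.
by rewrite ler_wpM2r ?mulr_ge0 ?exprn_ge0 ?ler0n // ler_int.
Qed.

End Transcendence.

(** * Factorial estimates and the choice of the parameters *)

(** Pair the factor [i + 1] with [n - i]: their product is at least [n]. *)
Lemma expn_le_fact_sqr n : (n ^ n <= n`! ^ 2)%N.
Proof.
have fE : n`! = (\prod_(i < n) i.+1)%N by rewrite fact_prod big_add1 /= big_mkord.
have fE' : n`! = (\prod_(i < n) (n - i))%N.
  rewrite fE (reindex_inj rev_ord_inj) /=; apply: eq_bigr => i _.
  by rewrite subnSK.
rewrite expnS expn1 {1}fE fE' -big_split /=.
have -> : (n ^ n = \prod_(i < n) n)%N by rewrite prod_nat_const card_ord.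
apply: leq_prod => i _; have hi := ltn_ord i.
by rewrite mulSn -{1}(subnK (ltnW hi)) leq_add2l leq_pmulr // subn_gt0.
Qed.

(** The quotient [(n + k n)! / (n! (k n)!)] is a binomial coefficient, hence at least 1. *)
Lemma fact_expn_le n k : (n`! ^ k <= (k * n)`!)%N.
Proof.
elim: k => [|k IH]; first by rewrite expn0 fact_gt0.
rewrite expnS mulSn -(bin_fact (leq_addr (k * n) n)) addKn.
by rewrite (leq_trans (leq_mul (leqnn _) IH)) // leq_pmull // bin_gt0 leq_addr.
Qed.

(* Chosen so that ((w+1) n)! >= n!^(w+1) beats the Liouville loss
   (n! b^n)^(K^2+1), where b <= K^6 n^2. *)
Definition pade_degree (K : nat) : nat := (5 * (K ^ 2 + 1)).+1.

(** Its n-th power collects the geometric factors of the Liouville loss, leaving only powers of [n]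
    and [n!]. *)
Definition pade_base (K : nat) : nat :=
  ((K ^ 9 * (8 * (pade_degree K)`!) ^ (pade_degree K).+1) ^ (K ^ 2 + 1))%N.

(** The first bound makes the value at [2 pi i] contribute at most 1/2 to the inequality for
    [2 pi i]; the second measures the factor of [eta] there. *)
Lemma pade_numeric (K n D b : nat) (w := pade_degree K) (s := (w.+1 * n)%N)
    (c := ((2 * w`!) ^ s)%N) (V := (b ^ n * (D * (n`! * c * b ^ n).+1) ^ D)%N) :
  (1 < K)%N -> (32 * pade_base K <= n)%N -> (D <= K ^ 2)%N -> (0 < b)%N ->
  (b <= K ^ 6 * n ^ 2)%N ->
  (2 * (V * (n`! * (8 * w`!) ^ s)) <= s`!)%N /\
  (V * (n`! * c * (n * 16 ^ n)) <= n ^ (n * (3 * (K ^ 2 + 1)).+1))%N.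
Proof.
move=> K1 hn hD b0 hb.
set Q := (K ^ 2 + 1)%N; set g := ((8 * w`!) ^ w.+1)%N.
have pow_mono (x y k : nat) : (x <= y)%N -> (x ^ k <= y ^ k)%N.
  by case: k => // k; rewrite leq_exp2r.
have w1 : (0 < w`!)%N by rewrite fact_gt0.
have gE : ((8 * w`!) ^ s = g ^ n)%N by rewrite /g /s expnM.
have cg : (c <= g ^ n)%N by rewrite -gE /c pow_mono // leq_mul2r orbT.
have g1 : (0 < g)%N by rewrite expn_gt0 muln_gt0 w1.
have c0 : (0 < c)%N by rewrite expn_gt0 muln_gt0 w1.
have n0 : (0 < n)%N.
  by apply: leq_trans hn; rewrite muln_gt0 expn_gt0 muln_gt0 !expn_gt0 muln_gt0 w1 (ltnW K1).
have nf : (0 < n`!)%N by rewrite fact_gt0.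
set y := pade_base K in hn.
have yE : y = ((K ^ 9 * g) ^ Q)%N by [].
have hV : (V * (n`! * g ^ n) <= y ^ n * (n ^ (2 * n * Q) * n`! ^ Q))%N.
  pose a := (K ^ 6 * n ^ 2)%N.
  have ban : (b ^ n <= a ^ n)%N by exact: pow_mono.
  have a0 : (0 < a)%N by exact: leq_trans hb.
  pose U := (n`! * g ^ n * a ^ n)%N.
  have U0 : (0 < U)%N by rewrite /U !muln_gt0 nf (expn_gt0 g) (expn_gt0 a) g1 a0.
  have h1 : (D * (n`! * c * b ^ n).+1 <= K ^ 3 * U)%N.
    have : (n`! * c * b ^ n <= U)%N by rewrite leq_mul // leq_mul2l cg orbT.
    have : (2 * K ^ 2 <= K ^ 3)%N by rewrite expnS leq_mul2r K1 orbT.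
    by move: (K ^ 2)%N (K ^ 3)%N hD => k2 k3 hD hk hU; nia.
  have h2 : ((D * (n`! * c * b ^ n).+1) ^ D <= (K ^ 3 * U) ^ (K ^ 2))%N.
    apply: leq_trans (pow_mono _ _ _ h1) _.
    by rewrite leq_pexp2l // muln_gt0 U0 expn_gt0 (ltnW K1).
  apply: (@leq_trans ((K ^ 3 * U) ^ Q)%N).
    rewrite /Q addn1 expnS mulnC.
    have -> : (n`! * g ^ n * V = (n`! * g ^ n * b ^ n) * (D * (n`! * c * b ^ n).+1) ^ D)%N.
      by rewrite /V !mulnA.
    apply: leq_mul h2; apply: (@leq_trans U); first by rewrite leq_mul2l ban orbT.
    by rewrite leq_pmull // expn_gt0 (ltnW K1).
  rewrite yE -expnM [(Q * n)%N]mulnC expnM.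
  have -> : (n ^ (2 * n * Q) = (n ^ (2 * n)) ^ Q)%N by rewrite expnM.
  rewrite -!expnMn; apply: pow_mono.
  have -> : (K ^ 3 * U = K ^ 3 * (K ^ 6) ^ n * (g ^ n * (n ^ (2 * n) * n`!)))%N.
    rewrite /U /a expnMn -(expnM n 2 n); ring.
  rewrite expnMn -[leqRHS]mulnA leq_mul2r; apply/orP; right.
  rewrite -(expnM K 6 n) -(expnM K 9 n) -(expnD K 3 (6 * n)).
  by apply: leq_pexp2l; [exact: ltnW K1 | clear -n0; lia].
have y0 : (0 < y)%N by rewrite yE expn_gt0 muln_gt0 g1 expn_gt0 (ltnW K1).
split.
  rewrite gE; apply: leq_trans (fact_expn_le n w.+1).
  (* In [n!^(w+1)], [Q] factors cancel [n!^Q]. The other [2 (2 Q + 1)] give [n^n] to the power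
     [2 Q + 1], which covers [n^(2 n Q)] and leaves one [n^n] to pay for [2 y^n]. *)
  have -> : (w.+1 = (2 * (2 * Q).+1 + Q))%N by rewrite /w /pade_degree -/Q; lia.
  rewrite expnD expnM.
  apply: (@leq_trans (2 * (y ^ n * (n ^ (2 * n * Q) * n`! ^ Q)))%N); first by rewrite leq_mul2l.
  rewrite !mulnA leq_mul2r; apply/orP; right.
  apply: (@leq_trans ((n ^ n) ^ (2 * Q).+1)%N); last exact/pow_mono/expn_le_fact_sqr.
  rewrite expnS -expnM mulnA -[(n * 2)%N]mulnC; apply: leq_mul => //.
  apply: (@leq_trans ((2 * y) ^ n)%N); last by apply: pow_mono; apply: leq_trans hn; rewrite leq_mul2r orbT.
  by rewrite expnMn leq_mul2r -{1}(expn1 2) leq_pexp2l ?orbT.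
apply: (@leq_trans (V * (n`! * g ^ n) * (n * 16 ^ n))%N).
  by rewrite !mulnA leq_mul2r leq_mul2r leq_mul2l cg !orbT.
apply: leq_trans (leq_mul hV (leqnn _)) _.
have n2 : (n * 16 ^ n <= 32 ^ n)%N.
  by rewrite -[32%N]/(2 * 16)%N expnMn leq_mul2r (ltnW (ltn_expl _ _)) ?orbT.
apply: leq_trans (leq_mul (leqnn _) n2) _.
have -> : (y ^ n * (n ^ (2 * n * Q) * n`! ^ Q) * 32 ^ n =
  (32 * y) ^ n * (n ^ (2 * n * Q) * n`! ^ Q))%N by rewrite expnMn; ring.
have -> : (n ^ (n * (3 * Q).+1) = n ^ n * (n ^ (2 * n * Q) * (n ^ n) ^ Q))%N.
  by rewrite -expnM -!expnD; congr (_ ^ _)%N; lia.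
by apply: leq_mul; [exact: pow_mono | rewrite leq_mul2l pow_mono ?orbT // fact_le_expn].
Qed.

(** * Points where the exponential is close to 1 *)

Section NearPeriod.
Variable R : realType.
Local Notation C := R[i].

(** A small sine forces [cos t >= 1/2], and the mean value theorem gives [sin t >= t cos t]. *)
Lemma sin_half_bound (t e : R) :
  0 <= t -> t <= pi / 2 -> sin t <= e -> e <= 1 / 8 -> t <= 2 * e.
Proof.
move=> t0 tpi st e8.
have s0 : 0 <= sin t by apply: sin_ge0_pi; rewrite t0 /=; have := pi_gt0 R; lra.
have [->|tn0] := eqVneq t 0; first by have := le_trans s0 st; lra.
have tp : 0 < t by rewrite lt_def tn0.
have c0 : 0 <= cos t by apply: cos_ge0_pihalf; rewrite tpi andbT; have := pi_gt0 R; lra.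
have c1 : 1 / 2 <= cos t by have := cos2Dsin2 t; nra.
have [x xt] : exists2 x, x \in `]0, t[ & sin t - sin 0 = cos x * (t - 0).
  apply: (@MVT R sin cos 0 t tp).
  by apply: derivable_within_continuous => x _; exact: derivable_sin.
rewrite sin0 !subr0 => sE; move: xt; rewrite in_itv /= => /andP[x0 xt].
have : cos t < cos x.
  by rewrite ltr_cos // in_itv /= ?t0 ?(ltW x0) /=; have := pi_gt0 R; lra.
nra.
Qed.

Lemma normr_cis_sub1 (v : R) : `|cis v - 1| ^+ 2 = ((2 * sin (v / 2)) ^+ 2)%:C.
Proof.
rewrite -add_Re2_Im2; congr (_%:C).
have -> : cis v - 1 = (cos v - 1) +i* sin v by rewrite /cis; simpc.
have h := cos2Dsin2 (v / 2).
have -> : cos v = cos (v / 2 + v / 2) by congr cos; field.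
have -> : sin v = sin (v / 2 + v / 2) by congr sin; field.
rewrite cosD sinD /=; nra.
Qed.

(** The modulus of [cexp z] controls the real part of [z]. The imaginary part is reduced modulo
    [2 pi] and controlled by the chord length [2 |sin(v/2)|]. The two contributions are [2 e] and
    [4 e]. *)
Lemma near_period (z : C) (e : R) :
  `|cexp z - 1| <= e%:C -> e <= 1 / 8 ->
  exists k : int, `|z - 'i * (pi *+ 2 * k%:~R)%:C| <= (8 * e)%:C.
Proof.
case: z => u v; rewrite /cexp /= -/(cis v) => he e8.
have e0 : 0 <= e by rewrite -ler0c; apply: le_trans he.
have eu0 := expR_gt0 u.
have nu : `|(expR u)%:C : C| = (expR u)%:C by rewrite ger0_norm // ler0c ltW.
have h1 : `|expR u - 1| <= e.
  rewrite -lecR; apply: le_trans he.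
  have := ler_dist_dist ((expR u)%:C * cis v) (1 : C).
  rewrite normrM normr_cis mulr1 nu normr1.
  have -> : (expR u)%:C - 1 = (expR u - 1)%:C :> C by rewrite rmorphB.
  by apply: le_trans; rewrite normc_def /= expr0n addr0 sqrtr_sqr.
have hu : `|u| <= 2 * e.
  move: h1; rewrite !ler_norml => /andP[h1 h2].
  have := expR_ge1Dx u; have := expR_ge1Dx (- u); rewrite expRN => h3 h4.
  have h5 : (expR u)^-1 <= 1 + 2 * e.
    by rewrite invf_ple ?posrE //; [rewrite -[leLHS]mul1r ler_pdivrMr|]; nra.
  by apply/andP; split; lra.
have h2 : `|cis v - 1| <= (2 * e)%:C.
  have -> : cis v - 1 = (1 - (expR u)%:C) * cis v + ((expR u)%:C * cis v - 1) by ring.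
  have -> : (2 * e)%:C = e%:C + e%:C :> C by rewrite mulrDl mul1r (rmorphD (real_complex R)).
  apply: le_trans (ler_normD _ _) _; rewrite lerD //.
  rewrite normrM normr_cis mulr1 -normrN opprB.
  have -> : (expR u)%:C - 1 = (expR u - 1)%:C :> C by rewrite rmorphB.
  by rewrite normc_def /= expr0n addr0 sqrtr_sqr lecR.
(* The shift by [pi] brings the remainder [v'] into [[-pi, pi)], where half of its modulus is at
   most [pi / 2]. *)
pose k := Num.floor ((v + pi) / (pi *+ 2)).
have p0 := pi_gt0 R.
have pp0 : 0 < pi *+ 2 :> R by rewrite pmulrn_lgt0.
pose v' : R := v - pi *+ 2 * k%:~R.
have [v1 v2] : - pi <= v' /\ v' < pi.
  have := floor_le_tmp ((v + pi) / (pi *+ 2)); have := floorD1_gt ((v + pi) / (pi *+ 2)).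
  rewrite -/k ltr_pdivrMr // ler_pdivlMr // /v' -mulr_natr => a b.
  by move: a b; rewrite -mulr_natr rmorphD /=; split; lra.
have cv : cis v' = cis v.
  have per (m : nat) (x : R) : cis (x + pi *+ 2 * m%:R) = cis x.
    by rewrite cisD [pi *+ 2 * _]mulrC cis_2pi mulr1.
  rewrite /v'; case: (k) => m; first by rewrite -[in RHS](subrK (pi *+ 2 * m%:R) v) per.
  by rewrite NegzE rmorphN /= mulrN opprK per.
have h3 : `|2 * sin (v' / 2)| <= 2 * e.
  have e2 : 0 <= 2 * e by rewrite mulr_ge0.
  rewrite -(ler_pXn2r (ltn0Sn 1)) ?nnegrE // real_normK ?num_real // -lecR -normr_cis_sub1 cv.
  rewrite (rmorphXn (real_complex R)) /=; apply: lerXn2r => //; by rewrite nnegrE ?normr_ge0 // ler0c.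
have hv : `|v'| <= 4 * e.
  have h4 : `|sin (v' / 2)| <= e by move: h3; rewrite normrM ger0_norm // ler_pM2l.
  have [v0|v0] := lerP 0 v'.
    rewrite ger0_norm //.
    have := @sin_half_bound (v' / 2) e; have := ler_norm (sin (v' / 2)); lra.
  rewrite ltr0_norm //.
  have := @sin_half_bound (- v' / 2) e; rewrite mulNr sinN.
  have := ler_norm (- sin (v' / 2)); rewrite normrN; lra.
exists k.
have -> : u +i* v - 'i * (pi *+ 2 * k%:~R)%:C = u%:C + 'i * v'%:C by rewrite /v'; simpc.
apply: le_trans (ler_normD _ _) _; rewrite normrM !normc_def /= !expr0n /= expr1n !addr0 add0r sqrtr1 !sqrtr_sqr mul1r.
by rewrite -rmorphD lecR /=; lra.
Qed.

End NearPeriod.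

(** * Explicit constants and bounds for the real parts *)

(** Liouville's constant for twice the real part: [K^(6 K^2)] comes from the characteristic
    polynomial, and [2 K^2 <= K^3] from the leading coefficients and the factor 2. *)
Definition re_bound (K : nat) : nat := (K ^ (6 * K ^ 2 + 3))%N.

Definition exponent (K : nat) : nat := (3 * (K ^ 2 + 1)).+1.

(** The first summand is what the Pade estimates require; the second makes the exponential win in
    [expR_dominates]. *)
Definition gap_threshold (K : nat) : nat :=
  (32 * pade_base K + 16 * (4 * re_bound K) ^ (exponent K).+1 * ((exponent K).+1)`!)%N.

Lemma expn_mono (x y k : nat) : (x <= y)%N -> (x ^ k <= y ^ k)%N.
Proof. by case: k => // k; rewrite leq_exp2r. Qed.

Lemma pade_base_ge K : (1 < K)%N -> (K ^ 9 <= pade_base K)%N.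
Proof.
move=> K1; have K0 := ltnW K1; rewrite /pade_base.
set g := ((8 * _) ^ _)%N; have g1 : (0 < g)%N by rewrite expn_gt0 muln_gt0 fact_gt0.
apply: (@leq_trans (K ^ 9 * g)%N); first by rewrite leq_pmulr.
rewrite -[leqLHS]expn1; apply: leq_pexp2l; last by rewrite addn1.
by rewrite muln_gt0 g1 andbT expn_gt0 K0.
Qed.

Section ReBounds.
Variable R : realType.
Local Notation C := R[i].
Variables (K : nat) (p : {poly int}) (g : C).
Hypotheses (K1 : (1 < K)%N) (p0 : p != 0) (sp : (size p <= K)%N).
Hypotheses (hp : forall i, `|p`_i| <= K%:Z) (rg : root (map_poly intr p) g).

(** The conjugate of [g] is a root of the same polynomial, so [g + g^* = 2 Re g] is a nonzero
    algebraic number, to which the Liouville estimate applies. *)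
Lemma Re_lower : 0 < complex.Re g -> 1 <= complex.Re g * (re_bound K)%:R.
Proof.
move=> g0; have K0 := ltnW K1.
have rgc : root (map_poly intr p) g^*.
  have := rg; rewrite -complex_root_conj -map_poly_comp.
  rewrite (eq_map_poly (g := intr)) // => i /=; exact: (rmorph_int (@conjc R)).
have [D [a [hD a0 ha hB]]] := linear_form_eigenvalue p0 p0 sp sp hp hp rg rgc.
have [B hb eB] := hB 1 1.
rewrite !mul1r addcJ in eB.
have hb' i j : `|B i j| <= (2 * K ^ 2)%N%:Z by apply: le_trans (hb i j) _; rewrite normr1.
have /(eigenvalue_lower hb' eB) : a%:~R * (2%:R * (complex.Re g)%:C) != 0 :> C.
  rewrite !mulf_neq0 ?intr_eq0 ?pnatr_eq0 //.
  by apply/eqP => /(congr1 (@complex.Re R)) /= e; move: g0; rewrite e ltxx.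
rewrite !normrM [`|(complex.Re g)%:C|]ger0_norm ?ler0c ?(ltW g0) // normr_nat -intr_norm.
have haN : (`|a|)%:~R <= (K ^ 2)%:R :> C by rewrite -[(K ^ 2)%:R]/((K ^ 2)%N%:Z%:~R) ler_int.
set W := ((D * _) ^ D)%N => h1.
have hW : (K ^ 2 * 2 * W <= re_bound K)%N.
  have h2 : (D * (2 * K ^ 2).+1 <= K ^ 6)%N.
    apply: (@leq_trans (K ^ 2 * K ^ 4)%N); last by rewrite -expnD.
    apply: leq_mul => //; have -> : (K ^ 4 = K ^ 2 * K ^ 2)%N by rewrite -expnD.
    have : (4 <= K ^ 2)%N by rewrite -[4%N]/(2 ^ 2)%N leq_exp2r.
    by move: (K ^ 2)%N => k2; nia.
  have h3 : (W <= K ^ (6 * K ^ 2))%N.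
    rewrite expnM; apply: leq_trans (expn_mono _ h2) _.
    by rewrite leq_pexp2l // expn_gt0 K0.
  rewrite /re_bound expnD mulnC leq_mul // [(K ^ 3)%N]expnSr leq_mul2l K1 orbT //.
rewrite -lecR rmorphM /= natrC; apply: (le_trans h1).
apply: (@le_trans _ _ ((K ^ 2)%:R * (2 * (complex.Re g)%:C) * W%:R)).
  by rewrite ler_wpM2r ?ler0n // ler_wpM2r // mulr_ge0 ?ler0n // ler0c ltW.
have -> : (K ^ 2)%:R * (2 * (complex.Re g)%:C) * W%:R = (complex.Re g)%:C * (K ^ 2 * 2 * W)%:R :> C.
  by rewrite !natrM; ring.
by rewrite ler_wpM2l ?ler0c ?(ltW g0) // ler_nat.
Qed.

Lemma Re_upper : complex.Re g <= (K ^ 4)%:R.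
Proof.
have [D [a [hD a0 ha hB]]] := linear_form_eigenvalue p0 p0 sp sp hp hp rg rg.
have [B hb eB] := hB 1 0.
rewrite mul0r addr0 mul1r in eB.
have hb' i j : `|B i j| <= (K ^ 2)%N%:Z by apply: le_trans (hb i j) _; rewrite normr1 normr0 addr0 mul1r.
have := eigenvalue_upper hb' eB; rewrite normrM -intr_norm => h.
have a1 : 1 <= (`|a|)%:~R :> C by rewrite -[1]/(1%:~R) ler_int -gtz0_ge1 normr_gt0.
rewrite -lecR natrC; apply: le_trans (_ : `|g| <= _).
  by apply: le_trans (normc_ge_Re _); rewrite lecR ler_norm.
apply: le_trans (_ : `|g| <= (`|a|)%:~R * `|g|) _; first by rewrite ler_peMl.
apply: (le_trans h); rewrite ler_nat -[4%N]/(2 + 2)%N expnD leq_mul //.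
Qed.

End ReBounds.

(** Extracting n-th roots leaves [16 n^c <= e^y] with [y] proportional to [n], which follows from
    the term of degree [c + 1] of the exponential series. *)
Lemma expR_dominates (R : realType) (K n : nat) : (1 < K)%N -> (gap_threshold K <= n)%N ->
  16 * (n ^ (n * exponent K))%:R <= expR (n%:R ^+ 2 / (4 * re_bound K)%:R) :> R.
Proof.
move=> K1 hn; set c := exponent K; set kp := (4 * re_bound K)%N.
have kp0 : (0 < kp)%N by rewrite muln_gt0 expn_gt0 (ltnW K1).
have hn2 : (16 * kp ^ c.+1 * (c.+1)`! <= n)%N by apply: leq_trans hn; exact: leq_addl.
clearbody kp.
have n0 : (0 < n)%N by apply: leq_trans hn2; rewrite muln_gt0 fact_gt0 andbT muln_gt0 (expn_gt0 kp) kp0.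
pose y : R := n%:R / kp%:R.
have y0 : 0 <= y by rewrite divr_ge0.
have -> : n%:R ^+ 2 / kp%:R = n%:R * y by rewrite /y expr2 mulrA.
rewrite expRM_natl.
have h : (16 * n ^ c)%:R <= expR y.
  apply: le_trans (expR_ge1Dxn c y0).
  apply: (@le_trans _ _ (y ^+ c.+1 / (c.+1)`!%:R)); last by rewrite lerDr.
  rewrite ler_pdivlMr ?ltr0n ?fact_gt0 // /y expr_div_n ler_pdivlMr ?exprn_gt0 ?ltr0n //.
  rewrite -!natrX -!natrM ler_nat [(n ^ c.+1)%N]expnS.
  have -> : (16 * n ^ c * (c.+1)`! * kp ^ c.+1 = 16 * kp ^ c.+1 * (c.+1)`! * n ^ c)%N.
    by rewrite mulnAC [(16 * n ^ c * _)%N]mulnAC mulnAC.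
  by rewrite leq_mul2r hn2 orbT.
apply: (@le_trans _ _ ((16 * n ^ c)%:R ^+ n)); last by rewrite lerXn2r ?nnegrE ?ler0n ?expR_ge0.
rewrite -natrX -natrM ler_nat expnMn -expnM [(c * n)%N]mulnC leq_mul2r.
by rewrite -{1}(expn1 16) leq_pexp2l ?orbT.
Qed.

(** * Lower bound for the distance from the exponential of a linear form to 1 *)

Section Gap.
Variable R : realType.
Local Notation C := R[i].
Variables (K : nat) (p q : {poly int}) (g d : C).
Hypotheses (K1 : (1 < K)%N) (p0 : p != 0) (q0 : q != 0).
Hypotheses (sp : (size p <= K)%N) (sq : (size q <= K)%N).
Hypotheses (hp : forall i, `|p`_i| <= K%:Z) (hq : forall i, `|q`_i| <= K%:Z).
Hypotheses (rg : root (map_poly intr p) g) (rd : root (map_poly intr q) d).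

Hypothesis hli : forall n1 n2 : nat, (0 < n1)%N -> n1%:R * g - n2%:R * d != 0.

(** Taking [n] to be the integer square root of [n1 + n2] keeps the height bound [b] polynomial in
    [n], while [n log n] stays small against [n1 + n2]. *)
Lemma cexp_gap (n n1 n2 : nat) (e : R) :
  (32 * pade_base K <= n)%N -> (0 < n1)%N ->
  (n ^ 2 <= n1 + n2)%N -> (n1 + n2 < n.+1 ^ 2)%N ->
  `|cexp (n1%:R * g - n2%:R * d) - 1| <= e%:C ->
  1 <= 16 * e * (n ^ (n * exponent K))%:R.
Proof.
move=> hn n10 nN Nn he; have K0 := ltnW K1.
have nK9 : (K ^ 9 <= n)%N.
  by apply: leq_trans hn; apply: leq_trans (pade_base_ge K1) _; rewrite leq_pmull.
have n0 : (0 < n)%N by apply: leq_trans nK9; rewrite expn_gt0 K0.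
set M := (n ^ _)%N; have M1 : (1 <= M)%N by rewrite expn_gt0 n0.
have MR : 1 <= M%:R :> R by rewrite ler1n.
have e0 : 0 <= e by rewrite -ler0c; apply: le_trans he.
(* For [e > 1/8] the claim is trivial. *)
have [e8|e8] := lerP e (1 / 8); last by nra.
have [k hk] := near_period he e8.
set be := n1%:R * g - n2%:R * d in he hk.
have [D [a [hD a0 ha hB]]] := linear_form_eigenvalue p0 q0 sp sq hp hq rg rd.
have [B hb eB] := hB n1%:Z (- n2%:Z).
have thE : a%:~R * (n1%:Z%:~R * g + (- n2%:Z)%:~R * d) = a%:~R * be :> C.
  by rewrite /be rmorphN /= mulNr.
rewrite thE in eB.
set N := (n1 + n2)%N in nN Nn.
pose H0 := (N * K ^ 2)%N; pose b := (K ^ 2 * H0)%N.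
have hb' i j : `|B i j| <= H0%:Z by apply: le_trans (hb i j) _; rewrite normrN.
have N0 : (0 < N)%N by rewrite /N addn_gt0 n10.
have hDb : (D * H0 <= b)%N by rewrite leq_mul2r hD orbT.
have H00 : (0 < H0)%N by rewrite muln_gt0 N0 expn_gt0 K0.
have b0 : (0 < b)%N by rewrite muln_gt0 H00 expn_gt0 K0.
have N4 : (N <= 4 * n ^ 2)%N by move: Nn; rewrite !expnS !expn0; nia.
have k24 : (4 <= K ^ 2)%N by rewrite -[4%N]/(2 ^ 2)%N leq_exp2r.
have Nk : (N <= K ^ 2 * n ^ 2)%N by apply: leq_trans N4 _; rewrite leq_mul2r k24 orbT.
have bn : (b <= K ^ 6 * n ^ 2)%N.
  rewrite /b /H0; have -> : (K ^ 6 = K ^ 2 * K ^ 2 * K ^ 2)%N by rewrite -!expnD.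
  by apply: leq_trans (leq_mul (leqnn _) (leq_mul Nk (leqnn _))) _; apply: eq_leq; ring.
have be0 : be != 0 by exact: hli.
have th0 : a%:~R * be != 0 by rewrite mulf_neq0 ?intr_eq0.
have haN : (`|a|)%:~R <= (K ^ 2)%:R :> C by rewrite -[(K ^ 2)%:R]/((K ^ 2)%N%:Z%:~R) ler_int.
(* For [k = 0] the linear form itself is small, and the Liouville estimate for its nonzero multiple
   [a * be] suffices. *)
have [k0|k0] := eqVneq k 0.
  have hbe : `|be| <= (8 * e)%:C by move: hk; rewrite k0 mulr0 mulr0 subr0.
  have h1 := eigenvalue_lower hb' eB th0.
  have hM : (K ^ 2 * (D * H0.+1) ^ D <= M)%N.
    have h2 : (D * H0.+1 <= n ^ 3)%N.
      apply: (@leq_trans (K ^ 9 * n ^ 2)%N); last by rewrite [(n ^ 3)%N]expnS leq_mul2r nK9 orbT.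
      apply: (@leq_trans (K ^ 8 * n ^ 2)%N); last by rewrite leq_mul2r leq_pexp2l ?orbT.
      have -> : (K ^ 8 = K ^ 2 * K ^ 2 * K ^ 2 * K ^ 2)%N by rewrite -!expnD.
      apply: (@leq_trans (K ^ 2 * (2 * H0))%N); first by apply: leq_mul; [exact: hD | rewrite mul2n -addnn -addn1 leq_add2l].
      apply: leq_trans (leq_mul (leqnn _) (leq_mul (leq_trans _ k24) (leq_mul Nk (leqnn _)))) _; first by [].
      by apply: eq_leq; ring.
    apply: (@leq_trans (n * (n ^ 3) ^ (K ^ 2))%N).
      apply: leq_mul; first by apply: leq_trans nK9; rewrite leq_pexp2l.
      apply: leq_trans (expn_mono _ h2) _.
      by rewrite leq_pexp2l // expn_gt0 n0.
    rewrite -expnM -expnS leq_pexp2l //; apply: (@leq_trans (exponent K)); last by rewrite leq_pmull.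
    by rewrite /exponent ltnS leq_mul2l addn1 leqnSn.
  have h3 : 1 <= 8 * e * M%:R.
    rewrite -lecR !(rmorphM (real_complex R)) /= !natrC; apply: (le_trans h1).
    rewrite normrM -intr_norm.
    apply: (@le_trans _ _ ((K ^ 2)%:R * (8 * e)%:C * ((D * H0.+1) ^ D)%:R)).
      by rewrite ler_wpM2r ?ler0n // ler_pM // ler0z.
    rewrite mulrAC -natrM mulrC (rmorphM (real_complex R)) /= natrC ler_wpM2l //.
      by rewrite mulr_ge0 ?ler0n ?ler0c.
    by rewrite ler_nat.
  by apply: le_trans h3 _; rewrite ler_wpM2r ?ler0n // ler_wpM2r // ler_nat.
(* For [k != 0], [be / k] is written as [(a * be) / (a * k)]: an eigenvalue of an integer matrix
   over a nonzero integer, close to [2 pi i]. *)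
have kF : k%:~R != 0 :> C by rewrite intr_eq0.
have k1 : 1 <= `|k%:~R : C| by rewrite -intr_norm -[1]/(1%:~R) ler_int -gtz0_ge1 normr_gt0.
have aF : a%:~R != 0 :> C by rewrite intr_eq0.
have n2pi (x : R) : `|'i * x%:C : C| = (`|x|)%:C.
  by rewrite normrM !normc_def /= !expr0n /= expr1n add0r addr0 sqrtr1 sqrtr_sqr mul1r.
have qE : (a%:~R * be) / (a * k)%:~R = be / k%:~R.
  by rewrite rmorphM /= invfM mulrACA mulfV // mul1r.
have hq1 : `|(a%:~R * be) / (a * k)%:~R - 'i * (pi *+ 2)%:C| <= (8 * e)%:C.
  rewrite qE.
  have -> : be / k%:~R - 'i * (pi *+ 2)%:C = (be - 'i * (pi *+ 2 * k%:~R)%:C) / k%:~R.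
    have -> : (pi *+ 2 * k%:~R)%:C = (pi *+ 2)%:C * k%:~R :> C.
      by rewrite (rmorphM (real_complex R)) /= (rmorph_int (real_complex R)).
    by field; rewrite kF.
  rewrite normrM normfV; apply: le_trans hk.
  by rewrite ler_pdivrMr ?(lt_le_trans ltr01 k1) // ler_peMr.
have hq2 : `|(a%:~R * be) / (a * k)%:~R| <= 16.
  rewrite -(subrK ('i * (pi *+ 2)%:C) (_ / _)); apply: le_trans (ler_normD _ _) _.
  rewrite n2pi (ger0_norm (double_pi_ge0 R)).
  apply: (@le_trans _ _ ((8 * e)%:C + (8 : R)%:C)); first by apply: lerD hq1 _; rewrite lecR double_pi_le8.
  by rewrite -[16]/(16%:R) -natrC -(rmorphD (real_complex R)) lecR /=; lra.
(* From [2 pi >= 4] one gets [4 |k| <= |be| + 1]; multiplied by [|a|], both terms on the right are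
   at most [b]. *)
have hm : `|a * k| <= b%:Z.
  have h4 : (`|a * k|)%:~R * 4 <= (b%:R : C) *+ 2.
    have h5 : (`|k|)%:~R * 4 <= `|be| + 1 :> C.
      have h6 : (8 * e)%:C <= (1 : R)%:C :> C by rewrite lecR; lra.
      have h7 : `|'i * (pi *+ 2 * k%:~R)%:C| <= `|be| + 1 :> C.
        rewrite -[X in `|X|](subrK be) addrC; apply: le_trans (ler_normD _ _) _.
        by rewrite lerD2l -normrN opprB; apply: le_trans hk h6.
      apply: le_trans h7; rewrite n2pi normrM (ger0_norm (double_pi_ge0 R)).
      rewrite (rmorphM (real_complex R)) /= -intr_norm (rmorph_int (real_complex R)) mulrC.
      rewrite ler_wpM2r ?ler0z // -[4]/(4%:R) -natrC lecR.
      by have := pi_ge2 R => h; rewrite mulr2n; lra.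
    rewrite normrM rmorphM /= -mulrA.
    apply: (@le_trans _ _ ((`|a|)%:~R * (`|be| + 1))); first by rewrite ler_wpM2l ?ler0z.
    rewrite mulrDr mulr1 mulr2n intr_norm -normrM; apply: lerD.
      apply: le_trans (eigenvalue_upper hb' eB) _; by rewrite ler_nat.
    rewrite -intr_norm; apply: (le_trans haN); rewrite ler_nat /b leq_pmulr //.
  have : (`|a * k| * 4)%:~R <= (b%:Z * 2)%:~R :> C.
    have -> : (b%:Z * 2)%:~R = (b%:R : C) *+ 2 by rewrite intrM mulr_natr.
    by rewrite intrM; exact: h4.
  rewrite ler_int => h8; rewrite -(ler_pM2r (_ : 0 < 4 :> int)) //; apply: (le_trans h8).
  by rewrite ler_wpM2l.
have ak0 : a * k != 0 by rewrite mulf_neq0.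
have main := pi_transcendence_inequality (erefl _) (erefl _) hb' hDb eB th0 ak0 hm hq2 hq1.
have {main} := main (pade_degree K) n.
have [h1 h2] := pade_numeric K1 hn hD b0 bn.
move: h1 h2; set w := pade_degree K; set s := (w.+1 * n)%N; set c := ((2 * w`!) ^ s)%N.
set V1 := ((D * _) ^ D)%N => h1 h2 main.
have sf : 0 < (s`!)%:R :> R by rewrite ltr0n fact_gt0.
(* The first summand is at most 1/2, so the second, at most [8 e M], is at least 1/2. *)
have i1 : (b ^ n)%:R * (n`!%:R * ((8 * w`!) ^ s)%:R / (s`!)%:R) * V1%:R <= 1 / 2 :> R.
  move: h1; rewrite -(ler_nat R) !natrM => h1.
  rewrite mulrA mulrAC ler_pdivrMr //; lra.
have i2 : (b ^ n)%:R * (8 * e * (n`! * c * (n * 16 ^ n))%:R) * V1%:R <= 8 * e * M%:R.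
  have -> : (b ^ n)%:R * (8 * e * (n`! * c * (n * 16 ^ n))%:R) * V1%:R =
     8 * e * ((b ^ n * V1) * (n`! * c * (n * 16 ^ n)))%N%:R :> R.
    by rewrite !(natrM _ (_ * _)) natrM; ring.
  by rewrite ler_wpM2l ?mulr_ge0 // ler_nat.
move: main; rewrite mulrDr mulrDl => main; lra.
Qed.

(** The denominator [4 * re_bound K] makes the loss at most a quarter of [n1 Re g + n2 Re d] once
    [re_bound K] bounds the inverses of both real parts. *)
Lemma cexp_gap_exp (n1 n2 : nat) :
  (0 < n1)%N -> ((gap_threshold K).+1 ^ 2 <= n1 + n2)%N ->
  (expR (- ((n1 + n2)%:R / (4 * re_bound K)%:R)))%:C <=
    `|cexp (n1%:R * g - n2%:R * d) - 1|.
Proof.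
move=> n10 hN; set N := (n1 + n2)%N in hN *.
have [n [nN Nn]] : exists n, (n ^ 2 <= N)%N /\ (N < n.+1 ^ 2)%N.
  elim: (N) => [|m [n [h1 h2]]]; first by exists 0%N.
  have [h|h] := ltnP m.+1 (n.+1 ^ 2); first by exists n; split=> //; exact: leqW.
  by exists n.+1; split=> //; move: h1 h2 h; rewrite !expnS !expn0; nia.
have tn : (gap_threshold K <= n)%N.
  have : ((gap_threshold K).+1 ^ 2 < n.+1 ^ 2)%N by exact: leq_ltn_trans Nn.
  by rewrite ltn_exp2r // ltnS => /ltnW.
set z := _ - 1; pose e := complex.Re `|z|.
have zE : `|z| = e%:C by rewrite /e normc_def.
rewrite zE lecR.
have hn : (32 * pade_base K <= n)%N by apply: leq_trans tn; exact: leq_addr.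
have := @cexp_gap n n1 n2 e hn n10 nN Nn; rewrite -/z zE lexx => /(_ isT) h.
have e0 : 0 <= e by rewrite -ler0c -zE.
have h2 := expR_dominates R K1 tn.
have h3 : expR (n%:R ^+ 2 / (4 * re_bound K)%:R) <= expR (N%:R / (4 * re_bound K)%:R) :> R.
  by rewrite ler_expR ler_wpM2r ?invr_ge0 ?ler0n // -natrX ler_nat.
rewrite expRN; have E0 := expR_gt0 (N%:R / (4 * re_bound K)%:R : R).
rewrite -[leLHS]mul1r ler_pdivrMr //; nra.
Qed.

End Gap.

(** * Counting *)

(* Importing [finmap] at top level would shadow [pickle]. *)
Module FsetCount.
Import finmap.

Lemma finite_set_seq (T : choiceType) (A : set T) (s : seq T) :
  (forall x, A x -> x \in s) -> finite_set A /\ (#|` fset_set A| <= size s)%N.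
Proof.
move=> h; have fA : finite_set A.
  by apply: sub_finite_set (finite_seq s) => x /h.
split=> //; apply: leq_trans (size_undup s).
rewrite -card_fseq; apply: fsubset_leq_card; apply/fsubsetP => x.
by rewrite in_fset_set // => /set_mem /h xs; rewrite inE.
Qed.

Lemma size_le_fset_set (T : choiceType) (A : set T) (s : seq T) :
  finite_set A -> uniq s -> (forall x, x \in s -> A x) -> (size s <= #|` fset_set A|)%N.
Proof.
move=> fA us h; rewrite -(undup_id us) -card_fseq.
apply: fsubset_leq_card; apply/fsubsetP => x.
by rewrite inE in_fset_set // => /h xA; apply/mem_set.
Qed.

End FsetCount.
Import FsetCount.

Section Counting.
Variable R : realType.
Local Notation C := R[i].

Lemma cexpD (z z' : C) : cexp (z + z') = cexp z * cexp z'.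
Proof.
case: z z' => a b [c d]; rewrite /cexp /= expRD -!/(cis _) cisD.
by rewrite (rmorphM (real_complex R)) /= mulrACA.
Qed.

Lemma cexp_natl n (z : C) : cexp (n%:R * z) = cexp z ^+ n.
Proof.
elim: n => [|n IH]; first by rewrite mul0r expr0 /cexp /= expR0 sin0 cos0 mul1r.
by rewrite -natr1 mulrDl mul1r cexpD IH exprSr.
Qed.

Lemma normr_cexp (z : C) : `|cexp z| = (expR (complex.Re z))%:C.
Proof. by rewrite /cexp normrM -/(cis _) normr_cis mulr1 ger0_norm // ler0c expR_ge0. Qed.

Lemma Re_natl n (z : C) : complex.Re (n%:R * z) = n%:R * complex.Re z.
Proof. by rewrite -natrC Re_real_mul. Qed.

Lemma expR1_le4 : expR 1 <= 4 :> R.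
Proof.
have := expR_ge1Dx (- (1 / 2) : R); rewrite expRN => h.
have e0 := expR_gt0 (1 / 2 : R).
have h2 : expR (1 / 2) <= 2 :> R.
  rewrite -[leRHS]invrK -[leLHS]invrK lef_pV2 ?posrE ?invr_gt0 //; lra.
have -> : expR 1 = expR (1 / 2) * expR (1 / 2) :> R by rewrite -expRD; congr expR; field.
nra.
Qed.

Lemma expR1_ge2 : 2 <= expR 1 :> R.
Proof. by have := expR_ge1Dx (1 : R); lra. Qed.

Variables (K : nat) (g d : C).
Let r : R := complex.Re g.
Let r' : R := complex.Re d.
Let kp : R := (re_bound K)%:R.
Let N0 : nat := ((gap_threshold K).+1 ^ 2)%N.
Hypotheses (r0 : 0 < r) (r'0 : 0 < r').
Hypotheses (rk : 1 <= r * kp) (r'k : 1 <= r' * kp).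
Hypotheses (rK : r <= (K ^ 4)%:R) (r'K : r' <= (K ^ 4)%:R).
Hypothesis gap : forall n1 n2 : nat, (0 < n1)%N -> (N0 <= n1 + n2)%N ->
  (expR (- ((n1 + n2)%:R / (4 * re_bound K)%:R)))%:C <= `|cexp (n1%:R * g - n2%:R * d) - 1|.

Lemma kp_ge1 : 1 <= kp.
Proof.
rewrite /kp; have : re_bound K != 0%N by apply: contraTneq rk; rewrite /kp => ->; rewrite mulr0 ler10.
by rewrite -lt0n ler1n.
Qed.

(** Both exponentials have modulus at most [x / e <= x / 2]. *)
Lemma Tset_lower (x : R) (n m : nat) : 0 < x -> (0 < n)%N -> (0 < m)%N ->
  n%:R * r <= ln x - 1 -> m%:R * r' <= ln x - 1 -> Tset g d x (n, m).
Proof.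
move=> x0 n0 m0 hn hm; split=> //=.
have half (t : R) : t <= ln x - 1 -> expR t <= x / 2.
  move=> ht; have h1 : expR t <= expR (ln x - 1) by rewrite ler_expR.
  apply: (le_trans h1); rewrite expRD expRN lnK ?posrE // ler_wpM2l ?(ltW x0) //.
  by rewrite lef_pV2 ?posrE ?expR_gt0 // expR1_ge2.
rewrite -!cexp_natl; apply: le_trans (ler_normB _ _) _.
rewrite !normr_cexp !Re_natl -rmorphD lecR /=.
by have := half _ hn; have := half _ hm; lra.
Qed.

Lemma Tset_upper (x : R) (n m : nat) : 0 < x -> N0%:R <= ln x ->
  Tset g d x (n, m) ->
  (n%:R * r <= ln x + 1 /\ m%:R * r' <= ln x + 1) \/
  (`|n%:R * r - m%:R * r'| < 1 /\ n%:R <= (4 * ln x + 4) * kp).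
Proof.
move=> x0 hx [/= n0 m0]; rewrite -!cexp_natl => hT.
set X := ln x in hx *; have xE : x = expR X by rewrite /X lnK.
have k1 := kp_ge1; have X0 : 0 <= X by apply: le_trans hx.
(* Real parts at distance at least 1 leave no room for cancellation: the difference of the moduli is
   at least [e^(t-1) (e - 1) >= e^(t-1)]. *)
have sep (s t : R) : s + 1 <= t -> expR t - expR s <= x -> t <= X + 1.
  move=> st h; rewrite -lerBlDr -ler_expR -xE; apply: le_trans h.
  have h1 : expR s <= expR (t - 1) by rewrite ler_expR; lra.
  have h2 : expR t = expR (t - 1) * expR 1 by rewrite -expRD subrK.
  have := expR1_ge2; have := expR_gt0 (t - 1); nra.
have dist : `|expR (n%:R * r) - expR (m%:R * r')| <= x.
  rewrite -lecR; apply: le_trans hT; apply: le_trans (ler_dist_dist _ _).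
  rewrite !normr_cexp !Re_natl -rmorphB /=.
  by rewrite normc_def /= expr0n addr0 sqrtr_sqr.
have d1 := le_trans (ler_norm _) dist.
have d2 : expR (m%:R * r') - expR (n%:R * r) <= x.
  by apply: le_trans dist; rewrite distrC ler_norm.
have [far|near] := lerP 1 `|n%:R * r - m%:R * r'|.
  left; have [h|h] := lerP 0 (n%:R * r - m%:R * r').
    by rewrite ger0_norm // in far; have := sep (m%:R * r') (n%:R * r); lra.
  by rewrite ltr0_norm // in far; have := sep (n%:R * r) (m%:R * r'); lra.
right; split=> //.
have nm : n%:R <= (n + m)%:R :> R by rewrite ler_nat leq_addr.
have [hN|hN] := ltnP (n + m) N0.
  have h3 : (n + m)%:R <= N0%:R :> R by rewrite ler_nat ltnW.
  nra.
have := gap n0 hN; set z := _ - 1 => hz.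
have h4 : expR (m%:R * r') * expR (- ((n + m)%:R / (4 * re_bound K)%:R)) <= x.
  rewrite -lecR; apply: le_trans hT.
  have -> : cexp (n%:R * g) - cexp (m%:R * d) = cexp (m%:R * d) * z.
    by rewrite /z mulrBr mulr1 -cexpD (addrC (m%:R * d)) subrK.
  rewrite normrM normr_cexp Re_natl (rmorphM (real_complex R)) /=.
  by rewrite ler_wpM2l // ler0c expR_ge0.
move: h4; rewrite -expRD {1}xE ler_expR natrM -/kp => h5.
move: near; rewrite ltr_norml => /andP[b1 b2].
(* The loss in the gap estimate. It gives [m r' <= X + u], hence [4 u <= 2 X + 1 + 2 u] because the
   real parts are close; so [u], and with it [n], is O(X). *)
pose u := (n + m)%:R / (4 * kp).
have uE : (n + m)%:R = 4 * kp * u by rewrite /u; field; lra.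
have h6 : m%:R * r' <= X + u by rewrite /u; lra.
have h7 : (n + m)%:R <= (n%:R * r + m%:R * r') * kp.
  rewrite natrD mulrDl -![_ * _ * kp]mulrA lerD //.
    by rewrite ler_peMr.
  by rewrite ler_peMr.
have u0 : 0 <= u by rewrite divr_ge0 ?mulr_ge0 //; lra.
have h8 : 4 * u <= 2 * X + 1 + 2 * u.
  rewrite -(ler_pM2r (_ : 0 < kp)); last by lra.
  have : (n%:R * r + m%:R * r') * kp <= (2 * X + 1 + 2 * u) * kp by rewrite ler_wpM2r //; lra.
  lra.
apply: (le_trans nm); rewrite uE; nra.
Qed.

(** For fixed [n], the [m] with [|n r - m r'| < 1] lie in an interval of length [2 / r']. Its left
    end is rounded down, and to 0 when negative. *)
Definition window_start (n : nat) : nat := Num.truncn ((n%:R * r - 1) / r').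

(** Explicit lists are counted: a rectangle of pairs from below; from above a larger rectangle
    followed by one window of boundedly many [m] for each [n = O(log x)]. *)
Lemma Tcount_bounds (x : R) : 0 < x -> N0%:R <= ln x ->
  finite_set (Tset g d x) /\
  (Num.truncn ((ln x - 1) / r) * Num.truncn ((ln x - 1) / r') <= Tcount g d x <=
   Num.truncn ((ln x + 1) / r) * Num.truncn ((ln x + 1) / r') +
   Num.truncn ((4 * ln x + 4) * kp) * (2 * re_bound K + 2))%N.
Proof.
move=> x0 hx; set X := ln x in hx *; have k1 := kp_ge1.
have X0 : 0 <= X by apply: le_trans hx.
set a := Num.truncn ((X + 1) / r); set b := Num.truncn ((X + 1) / r').
(* [J] is the bound [2 kp] for the window length, plus room for rounding. *)
set L := Num.truncn ((4 * X + 4) * kp); pose J := (2 * re_bound K + 2)%N.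
pose s := [seq (n, m) | n <- iota 1 a, m <- iota 1 b] ++
          [seq (n, (window_start n + j)%N) | n <- iota 1 L, j <- iota 0 J].
have trunc_ge (y t : R) (n : nat) : 0 < t -> n%:R * t <= y -> (n <= Num.truncn (y / t))%N.
  by case: n => // n t0 h; rewrite truncn_gt_nat ler_pdivlMr.
have hs p : Tset g d x p -> p \in s.
  case: p => n m pT; have [/= n0 m0 _] := pT.
  rewrite mem_cat; apply/orP; case: (Tset_upper x0 hx pT) => [[h1 h2]|[h1 h2]].
    left; apply/allpairsP; exists (n, m); split=> //=; rewrite mem_iota ?n0 ?m0 add1n ltnS /=.
      exact: trunc_ge.
    exact: trunc_ge.
  right; move: h1; rewrite ltr_norml => /andP[b1 b2].
  have wm : (window_start n <= m)%N.
    by rewrite truncn_le_nat ltr_pdivrMr // -natr1 mulrDl mul1r; have := r'0; lra.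
  have wl : (n%:R * r - 1) / r' < (window_start n).+1%:R by exact: truncnS_gt.
  have mJ : (m - window_start n < J)%N.
    rewrite -(ltr_nat R) natrB // /J natrD natrM -/kp.
    have hm : m%:R < (n%:R * r - 1) / r' + 2 / r' by rewrite -mulrDl ltr_pdivlMr //; lra.
    have hr : 2 / r' <= 2 * kp by rewrite ler_pdivrMr //; have := r'k; lra.
    by rewrite -natr1 in wl; lra.
  apply/allpairsP; exists (n, (m - window_start n)%N); split=> /=; last by rewrite subnKC.
    by rewrite mem_iota n0 add1n ltnS /= /L -[_ * kp]divr1 trunc_ge // mulr1.
  by rewrite mem_iota.
have [fT cT] := finite_set_seq hs.
split=> //; apply/andP; split; last first.
  by apply: leq_trans cT _; rewrite size_cat !size_allpairs !size_iota.
set a' := Num.truncn ((X - 1) / r); set b' := Num.truncn ((X - 1) / r').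
pose s' := [seq (n, m) | n <- iota 1 a', m <- iota 1 b'].
have -> : (a' * b' = size s')%N by rewrite size_allpairs !size_iota.
apply: size_le_fset_set => //.
  apply: allpairs_uniq; rewrite ?iota_uniq //; by move=> [? ?] [? ?].
have trunc_le (y t : R) (n : nat) : 0 < t -> (0 < n)%N -> (n <= Num.truncn (y / t))%N -> n%:R * t <= y.
  by case: n => // n t0 _; rewrite truncn_gt_nat ler_pdivlMr.
move=> [n m] /allpairsP[[n1 m1] /= [hn hm [-> ->]]].
move: hn hm; rewrite !mem_iota !add1n !ltnS => /andP[n0 hn] /andP[m0 hm].
by apply: Tset_lower => //; apply: trunc_le.
Qed.

Lemma Tcount_asymptotics (x : R) : 0 < x -> (N0 + K ^ 4 + 4)%:R <= ln x ->
  finite_set (Tset g d x) /\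
  `|(Tcount g d x)%:R - ln x ^+ 2 / (r * r')| <= (40 * re_bound K ^ 2)%:R * (ln x * ln (ln x)).
Proof.
move=> x0 hx; have k1 := kp_ge1.
have hx' : N0%:R + (K ^ 4)%:R + 4 <= ln x by move: hx; rewrite !natrD.
have K40 : 0 <= (K ^ 4)%:R :> R by exact: ler0n.
have N00 : 0 <= N0%:R :> R by exact: ler0n.
have hN : N0%:R <= ln x by lra.
have [fT /andP[lo up]] := Tcount_bounds x0 hN; split=> //.
set X := ln x in hx' hN lo up *; set T := (Tcount g d x)%:R.
(* Since [X >= 4 >= e]; this lets the stronger error term O(log x) be weakened to the stated one at
   the end. *)
have lnX : 1 <= ln X.
  rewrite -[leLHS]expRK ler_ln ?posrE ?expR_gt0 //; last by lra.
  by apply: le_trans expR1_le4 _; lra.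
pose i := r^-1; pose i' := r'^-1.
have i0 : 0 < i by rewrite invr_gt0.
have i'0 : 0 < i' by rewrite invr_gt0.
have ik : i <= kp by rewrite /i -[leLHS]mul1r ler_pdivrMr // mulrC.
have i'k : i' <= kp by rewrite /i' -[leLHS]mul1r ler_pdivrMr // mulrC.
have ri : r * i = 1 by rewrite mulfV // gt_eqF.
have ri' : r' * i' = 1 by rewrite mulfV // gt_eqF.
have trunc_up (y : R) : 0 <= y -> (Num.truncn y)%:R <= y by move=> y0; rewrite truncn_le.
have trunc_lo (y : R) : y - 1 <= (Num.truncn y)%:R.
  by have := truncnS_gt y; rewrite -natr1; lra.
have main : `|T - X ^+ 2 / (r * r')| <= 40 * kp ^+ 2 * X.
  rewrite invfM -/i -/i'.
  have hup : T <= (X + 1) ^+ 2 * (i * i') + (4 * X + 4) * kp * (2 * kp + 2).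
    move: up; rewrite -(ler_nat R) natrD !natrM natrD natrM -/kp -/T => h.
    apply: (le_trans h); apply: lerD; last first.
      by rewrite ler_wpM2r ?trunc_up ?mulr_ge0 //; lra.
    have -> : (X + 1) ^+ 2 * (i * i') = ((X + 1) / r) * ((X + 1) / r') by rewrite -/i -/i'; ring.
    by rewrite ler_pM ?ler0n // trunc_up // divr_ge0 ?ltW //; lra.
  have hlo : ((X - 1) * i - 1) * ((X - 1) * i' - 1) <= T.
    move: lo; rewrite -(ler_nat R) natrM -/T; apply: le_trans.
    (* The term [K ^ 4] of the threshold gives [X - 1 >= r] and [X - 1 >= r'], so both lower factors
       are nonnegative and can be multiplied. *)
    apply: ler_pM; rewrite ?trunc_lo // subr_ge0.
      by rewrite -ri; apply: ler_wpM2r; [exact: ltW | have := rK; lra].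
    by rewrite -ri'; apply: ler_wpM2r; [exact: ltW | have := r'K; lra].
  have ii : i * i' <= kp ^+ 2 by rewrite expr2 ler_pM // ltW.
  have ii0 : 0 < i * i' by rewrite mulr_gt0.
  have kk : kp <= kp ^+ 2 by rewrite expr2 ler_peMr //; lra.
  have X4 : 4 <= X by lra.
  set q := i * i' in hup ii ii0 *; set k2 := kp ^+ 2 in ii kk *.
  have e1 : (X + 1) ^+ 2 * q <= X ^+ 2 * q + 3 * X * k2.
    have : (2 * X + 1) * q <= 3 * X * k2 by apply: ler_pM; lra.
    lra.
  have e2 : (4 * X + 4) * kp * (2 * kp + 2) <= 32 * X * k2.
    have -> : (4 * X + 4) * kp * (2 * kp + 2) = 8 * (X + 1) * (k2 + kp) by rewrite /k2; ring.
    have : (X + 1) * (k2 + kp) <= (2 * X) * (2 * k2) by rewrite ler_pM //; lra.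
    lra.
  have e3 : X ^+ 2 * q - 4 * X * k2 <= ((X - 1) * i - 1) * ((X - 1) * i' - 1).
    have -> : ((X - 1) * i - 1) * ((X - 1) * i' - 1) =
      X ^+ 2 * q - (2 * X * q - q) - ((X - 1) * (i + i') - 1) by rewrite /q; ring.
    have f1 : X * q <= X * k2 by rewrite ler_wpM2l //; lra.
    have f2 : (X - 1) * (i + i') <= X * (2 * k2) by apply: ler_pM; lra.
    lra.
  have f3 : 0 <= X * k2 by rewrite mulr_ge0 //; lra.
  by rewrite ler_norml; apply/andP; split; lra.
apply: (le_trans main); rewrite natrM natrX -/kp -mulrA.
have -> : 40 * (kp ^+ 2 * X) = 40%:R * kp ^+ 2 * X by rewrite mulrA.
rewrite ler_wpM2l ?mulr_ge0 ?exprn_ge0 ?ler0n // ler_peMr //; lra.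
Qed.

End Counting.

(** * Codes and computable functions *)

Section Computability.
Local Open Scope nat_scope.

Lemma lt_pickle_pair (T1 T2 : countType) (a : T1) (b : T2) :
  (pickle a < pickle (a, b)).
Proof.
have -> : pickle (a, b) = CodeSeq.code [:: pickle a; pickle b] by [].
by case/andP: (CodeSeq.ltn_code [:: pickle a; pickle b]).
Qed.

Lemma lt_pickle_mem (T : countType) (s : seq T) x :
  x \in s -> (pickle x < pickle s).
Proof.
move=> xs; have -> : pickle s = CodeSeq.code (map pickle s) by [].
by have /allP := CodeSeq.ltn_code (map pickle s); apply; exact: map_f.
Qed.

Lemma size_le_code (s : seq nat) : (size s <= CodeSeq.code s).
Proof. by elim: s => //= n s IH; have := expn_gt0 2 n; nia. Qed.

Lemma size_le_pickle (T : countType) (s : seq T) : (size s <= pickle s).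
Proof.
have -> : pickle s = CodeSeq.code (map pickle s) by [].
by rewrite -(size_map pickle); exact: size_le_code.
Qed.

(** The successor is for [Negz n], whose absolute value is [n + 1]. *)
Lemma absz_le_pickle (z : int) : (`|z| <= (pickle z).+1)%N.
Proof.
case: z => n.
  have -> : pickle (Posz n) = CodeSeq.code [:: CodeSeq.code [:: n]; CodeSeq.code [::]] by [].
  have /andP[h _] := CodeSeq.ltn_code [:: CodeSeq.code [:: n]; CodeSeq.code [::]].
  by have /andP[h' _] := CodeSeq.ltn_code [:: n]; rewrite absz_nat; lia.
have -> : pickle (Negz n) = CodeSeq.code [:: CodeSeq.code [::]; CodeSeq.code [:: n]] by [].
have /and3P[_ h _] := CodeSeq.ltn_code [:: CodeSeq.code [::]; CodeSeq.code [:: n]].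
by have /andP[h' _] := CodeSeq.ltn_code [:: n]; lia.
Qed.

Lemma pickle_poly (p : {poly int}) : pickle p = pickle (p : seq int).
Proof. by []. Qed.

(** The code of a structure dominates the codes of its parts, so the number [pickle c] bounds size
    and coefficients without any decoding by the programs. *)
Lemma code_poly_bound (c : alg_code) :
  (size c.1.1 <= pickle c)%N /\ forall i, (absz (nth 0%R c.1.1 i) <= (pickle c).+1)%N.
Proof.
case: c => [[p d] r] /=.
have h1 := lt_pickle_pair (p, d) r; have h2 := lt_pickle_pair p d.
have h3 : (pickle (p : seq int) <= pickle (p, d, r))%N.
  by rewrite -pickle_poly (ltnW (ltn_trans h2 h1)).
split; first exact: leq_trans (size_le_pickle _) h3.
move=> i; have [ip|ip] := ltnP i (size p); last by rewrite nth_default.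
apply: leq_trans (absz_le_pickle _) _; rewrite ltnS.
exact: leq_trans (ltnW (lt_pickle_mem (mem_nth 0%R ip))) h3.
Qed.

Definition computable2 (f : nat -> nat -> nat) : Prop :=
  exists prog, forall a b, computes prog [:: a; b] (f a b).

Lemma computable2_comp f g h :
  computable2 f -> computable2 g -> computable2 h ->
  computable2 (fun a b => f (g a b) (h a b)).
Proof.
move=> [pf hf] [pg hg] [ph hh]; exists (RComp pf [:: pg; ph]) => a b.
apply: computes_comp (hf _ _).
by do 2?[apply: computes_cons => //]; exact: computes_nil.
Qed.

Lemma computable2_fst : computable2 (fun a _ => a).
Proof. by exists (RProj 0) => a b; exact: computes_proj. Qed.

Lemma computable2_snd : computable2 (fun _ b => b).
Proof. by exists (RProj 1) => a b; exact: (computes_proj 1 [:: a; b]). Qed.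

Definition rec_const n : recfun := iter n (fun f => RComp RSucc [:: f]) RZero.

Lemma rec_constP n s : computes (rec_const n) s n.
Proof.
elim: n => [|n IH]; first exact: computes_zero.
apply: computes_comp (computes_succ [:: n]).
by apply: computes_cons => //; exact: computes_nil.
Qed.

Lemma computable2_const n : computable2 (fun _ _ => n).
Proof. by exists (rec_const n) => a b; exact: rec_constP. Qed.

Definition rec_add : recfun := RPrec (RProj 0) (RComp RSucc [:: RProj 1]).

Lemma rec_addP a b s : computes rec_add [:: a, b & s] (a + b).
Proof.
elim: a => [|a IH].
  by apply: computes_prec0; exact: (computes_proj 0 (b :: s)).
apply: computes_precS IH _; apply: computes_comp (computes_succ [:: a + b]).
apply: computes_cons; last exact: computes_nil.
exact: (computes_proj 1 [:: a, a + b, b & s]).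
Qed.

Definition rec_mul : recfun :=
  RPrec RZero (RComp rec_add [:: RProj 1; RProj 2]).

Lemma rec_mulP a b s : computes rec_mul [:: a, b & s] (a * b).
Proof.
elim: a => [|a IH]; first by apply: computes_prec0; exact: computes_zero.
apply: computes_precS IH _; rewrite mulSn addnC.
apply: computes_comp (rec_addP _ _ [::]).
apply: computes_cons; first exact: (computes_proj 1 [:: a, a * b, b & s]).
apply: computes_cons; last exact: computes_nil.
exact: (computes_proj 2 [:: a, a * b, b & s]).
Qed.

(** Primitive recursion runs on the first argument, which is therefore the exponent. *)
Definition rec_exp : recfun :=
  RPrec (rec_const 1) (RComp rec_mul [:: RProj 2; RProj 1]).

Lemma rec_expP a b s : computes rec_exp [:: a, b & s] (b ^ a).
Proof.
elim: a => [|a IH]; first by apply: computes_prec0; exact: rec_constP.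
apply: computes_precS IH _; rewrite expnS.
apply: computes_comp (rec_mulP _ _ [::]).
apply: computes_cons; first exact: (computes_proj 2 [:: a, b ^ a, b & s]).
apply: computes_cons; last exact: computes_nil.
exact: (computes_proj 1 [:: a, b ^ a, b & s]).
Qed.

Definition rec_fact : recfun :=
  RPrec (rec_const 1) (RComp rec_mul [:: RComp RSucc [:: RProj 0]; RProj 1]).

Lemma rec_factP a s : computes rec_fact (a :: s) a`!.
Proof.
elim: a => [|a IH]; first by apply: computes_prec0; exact: rec_constP.
apply: computes_precS IH _; rewrite factS.
apply: computes_comp (rec_mulP _ _ [::]).
apply: computes_cons.
  apply: computes_comp (computes_succ [:: a]).
  apply: computes_cons; last exact: computes_nil.
  exact: (computes_proj 0 [:: a, a`! & s]).
apply: computes_cons; last exact: computes_nil.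
exact: (computes_proj 1 [:: a, a`! & s]).
Qed.

Section Closure.
Variables f g : nat -> nat -> nat.
Hypotheses (hf : computable2 f) (hg : computable2 g).

Lemma computable2_add : computable2 (fun a b => f a b + g a b).
Proof.
by apply: (@computable2_comp addn) => //; exists rec_add => a b; exact: rec_addP.
Qed.

Lemma computable2_mul : computable2 (fun a b => f a b * g a b).
Proof.
by apply: (@computable2_comp muln) => //; exists rec_mul => a b; exact: rec_mulP.
Qed.

Lemma computable2_exp : computable2 (fun a b => f a b ^ g a b).
Proof.
apply: (@computable2_comp (fun a b => b ^ a) g f) => //.
by exists rec_exp => a b; exact: rec_expP.
Qed.

Lemma computable2_fact : computable2 (fun a b => (f a b)`!).
Proof.
apply: (@computable2_comp (fun a _ => a`!) f f) => //.
by exists rec_fact => a b; exact: rec_factP.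
Qed.

Lemma computable2_succ : computable2 (fun a b => (f a b).+1).
Proof.
apply: (@computable2_comp (fun a _ => a.+1) f f) => //.
exists RSucc => a b; exact: (computes_succ [:: a; b]).
Qed.
End Closure.

End Computability.

(** * The effective constants and the asymptotic formula *)

(** The summand 2 ensures [K > 1] and absorbs the successor in the coefficient bound. *)
Definition code_bound (a b : nat) : nat := (a + b + 2)%N.

Definition error_constant (a b : nat) : nat := (40 * re_bound (code_bound a b) ^ 2)%N.

(** As [e <= 4], a power of 4 is an integer beyond which [ln x] exceeds the exponent. *)
Definition start_point (a b : nat) : nat :=
  (4 ^ ((gap_threshold (code_bound a b)).+1 ^ 2 + code_bound a b ^ 4 + 4))%N.

(** The constants are built from the codes by sums, products, powers, factorials and successors, so
    computability follows their syntax. *)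
Ltac computable_tac :=
  lazymatch goal with
  | |- computable2 (fun _ _ => ?c) => exact (computable2_const c)
  | |- computable2 (fun a _ => a) => exact computable2_fst
  | |- computable2 (fun _ b => b) => exact computable2_snd
  | |- computable2 (fun a b => (@?f a b + @?g a b)%N) =>
      apply (@computable2_add f g); computable_tac
  | |- computable2 (fun a b => (@?f a b * @?g a b)%N) =>
      apply (@computable2_mul f g); computable_tac
  | |- computable2 (fun a b => (@?f a b ^ @?g a b)%N) =>
      apply (@computable2_exp f g); computable_tac
  | |- computable2 (fun a b => (@?f a b)`!) => apply (@computable2_fact f); computable_tac
  | |- computable2 (fun a b => (@?f a b).+1) => apply (@computable2_succ f); computable_tac
  end.

Lemma computable_error_constant : computable2 error_constant.
Proof. by rewrite /error_constant /re_bound /code_bound; computable_tac. Qed.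

Lemma computable_start_point : computable2 start_point.
Proof.
rewrite /start_point /gap_threshold /exponent /re_bound /pade_base /pade_degree /code_bound.
by computable_tac.
Qed.

(** Effectivity is expressed by the order of quantifiers: two fixed programs serve all pairs of
    numbers and all their codes. *)
Theorem theorem3 (R : realType) :
  exists progC progx : recfun,
  forall gamma delta : R[i],
    algebraicOver ratr gamma ->
    algebraicOver ratr delta ->
    0 < complex.Re gamma ->
    0 < complex.Re delta ->
    lin_indep_rat gamma delta ->
  forall cgamma cdelta : alg_code,
    is_code cgamma gamma ->
    is_code cdelta delta ->
  exists C x0 : nat,
    [/\ computes progC [:: pickle cgamma; pickle cdelta] C,
        computes progx [:: pickle cgamma; pickle cdelta] x0 &
        forall x : R, x0%:R <= x ->
          finite_set (Tset gamma delta x) /\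
          `|(Tcount gamma delta x)%:R
            - ln x ^+ 2 / (complex.Re gamma * complex.Re delta)|
          <= C%:R * (ln x * ln (ln x))].
Proof.
have [progC hC] := computable_error_constant.
have [progx hx] := computable_start_point.
exists progC, progx => g d _ _ g0 d0 li cg cd [p0 rg _ _] [q0 rd _ _].
set a := pickle cg; set b := pickle cd.
exists (error_constant a b), (start_point a b); split=> // x xx.
pose K := code_bound a b.
have K1 : (1 < K)%N by rewrite /K /code_bound; lia.
have [sp hp'] := code_poly_bound cg; have [sq hq'] := code_poly_bound cd.
rewrite -/a in sp hp'; rewrite -/b in sq hq'.
have spK : (size cg.1.1 <= K)%N by rewrite /K /code_bound; lia.
have sqK : (size cd.1.1 <= K)%N by rewrite /K /code_bound; lia.
have hp i : `|cg.1.1`_i| <= K%:Z by have := hp' i; rewrite /K /code_bound; lia.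
have hq i : `|cd.1.1`_i| <= K%:Z by have := hq' i; rewrite /K /code_bound; lia.
have hli (n1 n2 : nat) : (0 < n1)%N -> n1%:R * g - n2%:R * d != 0.
  move=> n10; apply/eqP => e; have [] := li n1%:R (- n2%:R).
    by rewrite ratr_nat raddfN /= ratr_nat mulNr e.
  by move=> /eqP; rewrite pnatr_eq0 => /eqP n1E; rewrite n1E in n10.
apply: (@Tcount_asymptotics R K g d) => //.
- exact: (Re_lower K1 p0 spK hp rg g0).
- exact: (Re_lower K1 q0 sqK hq rd d0).
- exact: (Re_upper p0 spK hp rg).
- exact: (Re_upper q0 sqK hq rd).
- by move=> n1 n2; apply: (cexp_gap_exp K1 p0 q0 spK sqK hp hq rg rd hli).
- by apply: lt_le_trans xx; rewrite ltr0n expn_gt0.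
rewrite -/K; set m := (_ + 4)%N.
have h : (4 ^ m)%:R <= x by exact: xx.
rewrite -[leLHS]expRK ler_ln ?posrE ?expR_gt0 //; last first.
  by apply: lt_le_trans h; rewrite ltr0n expn_gt0.
apply: le_trans h; rewrite -[m%:R]mulr1 expRM_natl natrX.
by rewrite lerXn2r ?nnegrE ?expR_ge0 ?expR1_le4.
Qed.
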